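(* Let $\lambda\in(0,1]$, let $(\epsilon_i)_{i\ge1}$ be a sequence of reals with $\epsilon_i\to0$ and $\sum_{i>0}\epsilon_i^2=\infty$, and let $\mu=\bigotimes_{i\ge1}\mu_i$ on $X=\{0,1\}^{\mathbb N}$, where $$\mu_i(0)=\frac1{1+\lambda e^{\epsilon_i}},\qquad\mu_i(1)=\frac{\lambda e^{\epsilon_i}}{1+\lambda e^{\epsilon_i}},\qquad i>0.$$ Let $\mathcal R$ be the tail equivalence relation on $X$ and define a cocycle $\Lambda:\mathcal R\to\mathbb R$ by $\Lambda(x,y)=\sum_{i>0}(y_i-x_i)\log\lambda$. Then the cocycle $\alpha:=\log\Delta_{\mathcal R,\mu}-\Lambda$ of $\mathcal R$ with values in $\mathbb R$ is ergodic.
   Context: Two points $x,y\in X$ are tail equivalent if $x_i=y_i$ for all sufficiently large $i$. The Radon-Nikodym cocycle of $(\mathcal R,\mu)$ is $\Delta_{\mathcal R,\mu}(x,y)=\prod_{i>0}\mu_i(y_i)/\mu_i(x_i)$ for $(x,y)\in\mathcal R$ (a finite product). A cocycle $\alpha:\mathcal R\to\mathbb R$ is ergodic if the equivalence relation on $(X\times\mathbb R,\mu\times\mathrm{Leb})$ given by $(x,g)\sim(y,\alpha(x,y)+g)$, $(x,y)\in\mathcal R$, is ergodic, i.e. every Borel set invariant under it is null or conull. *)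

(* Defs.v *)
From HB Require Import structures.
From mathcomp Require Import all_boot all_order all_algebra.
From mathcomp Require Import all_classical all_reals all_analysis.
From mathcomp Require Import measurable_realfun ring lra.

Set Implicit Arguments.
Unset Strict Implicit.
Unset Printing Implicit Defensive.

Import Order.TTheory GRing.Theory Num.Theory.
Import numFieldNormedType.Exports.

Local Open Scope classical_set_scope.
Local Open Scope ring_scope.

(* {0,1}^N with its Borel sigma-algebra; coordinates are numbered from 0 *)
Definition binseq := g_sigma_algebraType (@open cantor_space).

Definition box (n : nat) (A : nat -> set bool) : set binseq :=
  [set x : binseq | forall i, (i < n)%N -> A i (x i)].

Section product_measure.
Context {R : realType}.
Implicit Type nu : nat -> probability bool R.

(* mu is the product of the nu i; it exists and is unique, see
   product_measure_exists and product_measure_uniq below *)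
Definition is_product_measure nu (mu : set binseq -> \bar R) : Prop :=
  forall (n : nat) (A : nat -> set bool),
    mu (box n A) = (\big[*%E/1%E]_(i < n) nu i (A i))%E.

End product_measure.

Definition tail_equiv (x y : binseq) : Prop := \forall i \near \oo, x i = y i.

Section cocycles.
Context {R : realType}.

(* Values outside E are irrelevant *)
Definition is_cocycle (E : binseq -> binseq -> Prop)
    (c : binseq -> binseq -> R) : Prop :=
  forall x y z, E x y -> E y z -> c x z = c x y + c y z.

(* For tail equivalent x and y only finitely many factors differ from 1, and
   the \in-indexed big operator is the product of those. *)
Definition Radon_Nikodym_cocycle (nu : nat -> probability bool R)
    (x y : binseq) : R :=
  \big[*%R/1]_(i \in [set: nat]) (fine (nu i [set y i]) / fine (nu i [set x i])).

Definition count_cocycle (a : R) (x y : binseq) : R :=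
  \sum_(i \in [set: nat]) ((y i)%:R - (x i)%:R) * a.

Definition skew_relation (E : binseq -> binseq -> Prop)
    (c : binseq -> binseq -> R) (s t : binseq * measurableTypeR R) : Prop :=
  E s.1 t.1 /\ t.2 = c s.1 t.1 + s.2.

End cocycles.

Definition invariant_set {T : Type} (E : T -> T -> Prop) (A : set T) : Prop :=
  forall s t, E s t -> (A s <-> A t).

Definition ergodic_relation {d} {T : measurableType d} {R : realType}
    (m : set T -> \bar R) (E : T -> T -> Prop) : Prop :=
  forall A : set T, measurable A -> invariant_set E A ->
    m A = 0%E \/ m (~` A) = 0%E.

Definition ergodic_cocycle {R : realType} (mu : probability binseq R)
    (E : binseq -> binseq -> Prop) (c : binseq -> binseq -> R) : Prop :=
  ergodic_relation (mu \x @lebesgue_measure R)%E (skew_relation E c).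

Definition boxes : set (set binseq) :=
  [set B | exists n A, B = box n A].

Lemma boxI_closed : setI_closed boxes.
Proof.
move=> _ _ [n [A ->]] [m [B ->]].
exists (maxn n m), (fun i => (if (i < n)%N then A i else setT) `&`
  (if (i < m)%N then B i else setT)).
rewrite /box; apply/seteqP; split => x /=.
  move=> [xA xB] i _; split.
    by case: ifPn => // /xA.
  by case: ifPn => // /xB.
move=> xAB; split => i im.
  by have := xAB i; rewrite leq_max im/= => /(_ isT) [].
by have := xAB i; rewrite leq_max im/= orbT => /(_ isT) [].
Qed.

Lemma box_prefix_open (U : set cantor_space) (x : cantor_space) :
  open U -> U x -> exists n, box n (fun i => [set x i]) `<=` U.
Proof.
move=> oU Ux; apply: contrapT => /forallNP noU.
have /choice[y yP] n : exists y : cantor_space,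
    box n (fun i => [set x i]) y /\ ~ U y.
  by have /existsNP[y /not_implyP[? ?]] := noU n; exists y.
have yx : y @ \oo --> x.
  apply/cvg_sup => N V [W] [[Z] oZ <-] ZxN ZV.
  apply: (filterS ZV); rewrite nbhs_simpl; exists N.+1 => // i /= Ni.
  by have [/(_ N Ni) -> _] := yP i.
have : nbhs x U by apply: open_nbhs_nbhs.
by move=> /yx; rewrite nbhs_simpl => -[N _ /(_ N (leqnn N))] /=; have [_] := yP N.
Qed.

Lemma measurable_coordinate (i : nat) :
  measurable_fun [set: binseq] (fun x : binseq => x i).
Proof.
move=> _ B _; rewrite setTI; apply: sub_sigma_algebra.
apply: (@open_comp cantor_space bool (fun x => x i)); last exact: discrete_open.
by move=> x _; exact: (@proj_continuous nat (fun=> bool) i).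
Qed.

Lemma measurable_box n A : measurable (box n A).
Proof.
rewrite (_ : box n A = \bigcap_(i in `I_n) ((fun x : binseq => x i) @^-1` A i)).
  apply: bigcap_measurableType => i _; rewrite -[X in measurable X]setTI.
  exact: measurable_coordinate.
by apply/seteqP; split => x /=.
Qed.

Lemma measurable_binseqE : @measurable _ binseq = <<s boxes >>.
Proof.
apply/seteqP; split; last first.
  apply: smallest_sub; first exact: sigma_algebra_measurable.
  by move=> _ [n [A ->]]; exact: measurable_box.
apply: smallest_sub; first exact: smallest_sigma_algebra.
move=> U oU.
pose C (w : seq bool) := box (size w) (fun i => [set nth false w i]).
rewrite (_ : U = \bigcup_(w in [set w | C w `<=` U]) C w).
  rewrite bigcup_mkcond.
  apply: (@countable_bigcupT_measurable _ (g_sigma_algebraType boxes)).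
    exact: countableP.
  move=> w; case: ifPn => _; last exact: (@measurable0 _ (g_sigma_algebraType boxes)).
  by apply: sub_sigma_algebra; exists (size w), (fun i => [set nth false w i]).
apply/seteqP; split => [x Ux|x [w /= CU]]; last exact: CU.
have [n nU] := box_prefix_open oU Ux.
pose w := mkseq x n.
exists w => /=.
  move=> y Cy; apply: nU => i ni /=; rewrite Cy ?size_mkseq// nth_mkseq//.
by move=> i; rewrite size_mkseq => ni /=; rewrite nth_mkseq.
Qed.

Lemma product_measure_uniq (R : realType) (nu : nat -> probability bool R)
    (mu mu' : probability binseq R) :
  is_product_measure nu mu -> is_product_measure nu mu' ->
  forall A, measurable A -> mu A = mu' A.
Proof.
move=> muP mu'P A mA.
apply: (measure_unique boxes (fun=> setT)) => //.
- exact: measurable_binseqE.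
- exact: boxI_closed.
- by move=> _; exists 0%N, (fun=> setT); apply/seteqP; split.
- by rewrite bigcup_const.
- by move=> _ [n [B ->]]; exact: etrans (muP n B) (esym (mu'P n B)).
- by move=> _; apply: fin_num_fun_lty; exact: fin_num_measure.
Qed.

Section product_measure_existence.
Context {R : realType} (nu : nat -> probability bool R).

(* The product measure is the image of Lebesgue measure on [0, 1[ under code:
   [0, 1[ is cut at each stage into two intervals of relative lengths
   w i false and w i true, and code u records the successive sides of u;
   an interval is encoded by its left end point and its length. *)
Let w (i : nat) (b : bool) : R := fine (nu i [set b]).

Let wE i b : nu i [set b] = (w i b)%:E.
Proof. by rewrite /w fineK// fin_num_measure. Qed.

Let w_ge0 i b : 0 <= w i b.
Proof. by rewrite -lee_fin -wE. Qed.

Let nuE i (A : set bool) :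
  nu i A = ((true \in A)%:R * w i true + (false \in A)%:R * w i false)%:E.
Proof.
rewrite [in LHS](_ : A = (if true \in A then [set true] else set0) `|`
  (if false \in A then [set false] else set0)); last first.
  apply/seteqP; split => [[] Ab|b].
  - by left; rewrite mem_set.
  - by right; rewrite mem_set.
  - by case; case: ifPn => //; rewrite inE => Ab ->.
rewrite measureU//; last first.
  by apply/seteqP; split => // b; case: ifPn => // _ [] + ; case: ifPn => // _ /= ->.
rewrite EFinD; congr (_ + _)%E.
  by case: (true \in A); rewrite ?measure0 /= ?mulr1n ?mulr0n ?mul0r ?mul1r ?wE.
by case: (false \in A); rewrite ?measure0 /= ?mulr1n ?mulr0n ?mul0r ?mul1r ?wE.
Qed.

Let w1 i : w i true + w i false = 1.
Proof.
by apply/EFin_inj; rewrite -(probability_setT (nu i)) nuE !in_setT !mul1r.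
Qed.

Let step (i : nat) (b : bool) (al : R * R) : R * R :=
  if b then (al.1 + al.2 * w i false, al.2 * w i true)
  else (al.1, al.2 * w i false).

Let cut (i : nat) (al : R * R) : R := al.1 + al.2 * w i false.

Fixpoint code_itv (u : R) (n : nat) : R * R :=
  if n is m.+1 then step m (cut m (code_itv u m) <= u) (code_itv u m)
  else (0, 1).

Definition code (u : R) : binseq := fun n => cut n (code_itv u n) <= u.

Fixpoint word_itv (s : nat -> bool) (n : nat) : R * R :=
  if n is m.+1 then step m (s m) (word_itv s m) else (0, 1).

Let code_itvE s u n : (forall i, (i < n)%N -> code u i = s i) ->
  code_itv u n = word_itv s n.
Proof.
elim: n => //= n IH us; rewrite IH; last by move=> i ni; apply/us/ltnW.
by rewrite -(us n)// /code IH// => i ni; apply/us/ltnW.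
Qed.

Let word_itv2 s n : (word_itv s n).2 = \prod_(i < n) w i (s i).
Proof.
elim: n => [|n IH]; first by rewrite big_ord0.
by rewrite big_ord_recr/= -IH /step; case: (s n).
Qed.

Let word_itv2_ge0 s n : 0 <= (word_itv s n).2.
Proof. by rewrite word_itv2; apply: prodr_ge0. Qed.

Let word_itv_sub s n :
  0 <= (word_itv s n).1 /\ (word_itv s n).1 + (word_itv s n).2 <= 1.
Proof.
elim: n => [|n [IH1 IH2]] /=; first by split; lra.
have := word_itv2_ge0 s n; have := w1 n; have := w_ge0 n true.
by have := w_ge0 n false; rewrite /step; case: (s n) => /=; split; nra.
Qed.

Let codeP s n u : 0 <= u < 1 ->
  (forall i, (i < n)%N -> code u i = s i) <->
  (word_itv s n).1 <= u < (word_itv s n).1 + (word_itv s n).2.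
Proof.
move=> u01; elim: n => [|n IH] /=; first by rewrite add0r; split.
have := word_itv2_ge0 s n; have := w1 n; have := w_ge0 n true.
have := w_ge0 n false; rewrite /step => wf wt w1n l0.
have -> : (forall i, (i < n.+1)%N -> code u i = s i) <->
    (forall i, (i < n)%N -> code u i = s i) /\ code u n = s n.
  split=> [us|[us usn] i]; first by split=> [i ni|]; apply: us => //; exact/ltnW.
  by rewrite ltnS leq_eqVlt => /predU1P[->|/us].
split=> [[us usn]|].
  have /IH := us; move: usn; rewrite /code (code_itvE us) /cut.
  case: (s n) => /=; first by move=> ? ?; nra.
  by move/negbT; rewrite -ltNge => ? ?; nra.
move=> h; have us : forall i, (i < n)%N -> code u i = s i.
  by apply/IH; move: h; case: (s n) => /=; nra.
split=> //; rewrite /code (code_itvE us) /cut.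
move: h; case: (s n) => /=; first by nra.
by move=> ?; apply/negbTE; rewrite -ltNge; nra.
Qed.

Let measurable_code : measurable_fun [set: measurableTypeR R] code.
Proof.
have mitv n : measurable_fun [set: measurableTypeR R] (fun u => (code_itv u n).1)
    /\ measurable_fun [set: measurableTypeR R] (fun u => (code_itv u n).2).
  elim: n => [|n [IH1 IH2]] /=; first by split; exact: measurable_cst.
  have mc : measurable_fun [set: measurableTypeR R]
      (fun u => cut n (code_itv u n) <= u).
    apply: measurable_fun_ler => //.
    by apply: measurable_funD => //; exact: measurable_funM.
  rewrite /step; split.
    under eq_fun do rewrite (fun_if fst)/=.
    apply: measurable_fun_ifT => //.
    by apply: measurable_funD => //; exact: measurable_funM.
  under eq_fun do rewrite (fun_if snd)/=.
  by apply: measurable_fun_ifT => //; exact: measurable_funM.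
apply: (measurability boxes); first exact: measurable_binseqE.
move=> _ [_ [n [A ->]] <-]; rewrite setTI.
rewrite (_ : _ @^-1` _ = \bigcap_(i in `I_n) ((fun u => code u i) @^-1` A i)).
  apply: bigcap_measurableType => i _; rewrite -[X in measurable X]setTI.
  have [m1 m2] := mitv i.
  have mc : measurable_fun [set: measurableTypeR R] (fun u => code u i).
    apply: measurable_fun_ler => //.
    by apply: measurable_funD => //; exact: measurable_funM.
  exact: mc.
by apply/seteqP; split => x /=.
Qed.

Let m01 : measurable (`[0, 1[%classic : set (measurableTypeR R)).
Proof. exact: measurable_itv. Qed.

Let leb01 : {measure set (measurableTypeR R) -> \bar R} :=
  mrestr (@lebesgue_measure R) m01.

Let coded : {measure set binseq -> \bar R} :=
  measure_function_pushforward__canonical__measure_function_Measure leb01 measurable_code.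

Let coded_word s n :
  coded (box n (fun i => [set s i])) = (\prod_(i < n) w i (s i))%:E.
Proof.
rewrite /coded /= /pushforward /leb01 /= /mrestr.
rewrite (_ : _ `&` _ = [set` `[(word_itv s n).1,
    (word_itv s n).1 + (word_itv s n).2[]).
  rewrite lebesgue_measure_itv /= lte_fin -word_itv2.
  have := word_itv2_ge0 s n.
  case: ifPn; first by rewrite -EFinB addrAC subrr add0r.
  by rewrite ltrDl -leNgt => a b; congr _%:E; apply/eqP; rewrite eq_le a b.
have [a0 l1] := word_itv_sub s n.
apply/seteqP; split => u /=; rewrite !in_itv/=.
  by move=> [h u01]; apply/codeP.
move=> h; have u01 : 0 <= u < 1 by move: h => /andP[? ?]; apply/andP; split; lra.
by split=> //; apply/(codeP _ _ u01).
Qed.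

Let coded_mixed m k s A :
  coded (box (k + m) (fun i => if (i < k)%N then [set s i] else A i)) =
  ((\prod_(i < k) w i (s i))%:E * \big[*%E/1%E]_(k <= i < k + m) nu i (A i))%E.
Proof.
elim: m k s => [|m IH] k s.
  rewrite addn0 big_geq// mule1 -coded_word; congr (coded _).
  by apply/seteqP; split=> x /= h i ik; have := h i ik; rewrite ik.
have km : (k < k + m.+1)%N by rewrite addnS ltnS leq_addr.
rewrite big_ltn//.
pose B := box (k + m.+1) (fun i => if (i < k)%N then [set s i] else A i).
pose upd b i := if (i < k)%N then s i else b.
have BE b : B `&` [set x : binseq | x k = b] =
    if b \in A k then box (k.+1 + m)
      (fun i => if (i < k.+1)%N then [set upd b i] else A i) else set0.
  case: ifPn => [|/negP] Akb.
    apply/seteqP; split => x /=.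
      move=> [Bx xk] i; rewrite addSnnS => /Bx; rewrite ltnS [(i <= k)%N]leq_eqVlt /upd.
      by case: ltngtP => //= ->.
    move=> h; split.
      move=> i; rewrite -addSnnS => /h; rewrite ltnS [(i <= k)%N]leq_eqVlt /upd.
      by case: ltngtP => //= -> ->; move: Akb; rewrite inE.
    by have := h k; rewrite ltnSn /upd ltnn; apply; rewrite addSnnS.
  apply/seteqP; split => x //= [Bx xk]; apply: Akb; rewrite inE -xk.
  by have := Bx k km; rewrite ltnn.
have mk b : measurable [set x : binseq | x k = b].
  rewrite -[X in measurable X]setTI.
  exact: (@measurable_coordinate k measurableT [set b] I).
have mB : measurable B by exact: measurable_box.
rewrite -/B; have BU : B = (B `&` [set x : binseq | x k = true]) `|`
    (B `&` [set x : binseq | x k = false]).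
  rewrite -setIUr (_ : _ `|` _ = setT) ?setIT//.
  by apply/seteqP; split => x //= _; case: (x k); [left|right].
have cB : coded B = (coded (B `&` [set x : binseq | x k = true]) +
    coded (B `&` [set x : binseq | x k = false]))%E.
  rewrite [X in coded X = _]BU; apply: measureU; try exact: measurableI.
  by apply/seteqP; split => x //= [[_ ->] [_]].
have coded_upd b : coded (B `&` [set x : binseq | x k = b]) =
    ((\prod_(i < k) w i (s i))%:E * ((b \in A k)%:R * w k b)%:E
     * \big[*%E/1%E]_(k.+1 <= i < k.+1 + m) nu i (A i))%E.
  rewrite BE; case: ifPn => _; last by rewrite mul0r mule0 mul0e measure0.
  rewrite IH mul1r -EFinM; congr (_%:E * _)%E.
  rewrite big_ord_recr/= /upd ltnn; congr (_ * _).
  by apply: eq_bigr => i _; rewrite ltn_ord.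
apply: (etrans cB); rewrite !coded_upd nuE -addSnnS muleA.
have [r r0 ->] : exists2 r, 0 <= r &
    \big[*%E/1%E]_(k.+1 <= i < k.+1 + m) nu i (A i) = r%:E.
  elim/big_ind: _ => [|_ _ [x ? ->] [y ? ->]|i _]; first by exists 1.
    by exists (x * y); rewrite ?mulr_ge0// EFinM.
  by exists (fine (nu i (A i))); rewrite ?fine_ge0// fineK// fin_num_measure.
by rewrite -!EFinM -EFinD mulrDr mulrDl.
Qed.

Lemma product_measure_exists :
  exists mu : probability binseq R, is_product_measure nu mu.
Proof.
have codedP : is_product_measure nu coded.
  move=> n A; have := coded_mixed n 0 (fun=> true) A.
  by rewrite big_ord0 mul1e add0n big_mkord.
have coded1 : coded setT = 1%E.
  rewrite (_ : setT = box 0 (fun=> setT)) ?codedP ?big_ord0//.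
  by apply/seteqP; split.
pose P := Measure_isProbability.Build _ _ _ coded coded1.
pose mu : probability binseq R := HB.pack (Measure.sort coded) P.
by exists mu.
Qed.

End product_measure_existence.

Section cocycle_theory.
Context {R : realType}.
Implicit Type nu : nat -> probability bool R.

Lemma tail_fsbig (idx : R) (op : Monoid.com_law idx) (F : bool -> bool -> nat -> R)
    (x y : binseq) (n : nat) :
  (forall b i, F b b i = idx) -> (forall i, (n <= i)%N -> x i = y i) ->
  \big[op/idx]_(i \in [set: nat]) F (x i) (y i) i =
  \big[op/idx]_(i < n) F (x i) (y i) i.
Proof.
move=> F1 xy; rewrite (fsbig_ord _ _ (fun i => F (x i) (y i) i)).
apply/esym/fsbig_widen => // i [_ /negP]; rewrite -leqNgt => /xy xyi.
by rewrite /= xyi F1.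
Qed.

Lemma count_cocycleE (a : R) x y n : (forall i, (n <= i)%N -> x i = y i) ->
  count_cocycle a x y = \sum_(i < n) ((y i)%:R - (x i)%:R) * a.
Proof.
move=> xy; apply: (@tail_fsbig 0 +%R (fun b c _ => ((c%:R - b%:R) * a))) => //.
by move=> b i; rewrite subrr mul0r.
Qed.

Lemma Radon_Nikodym_cocycleE nu x y n :
  (forall i b, (0 < nu i [set b])%E) -> (forall i, (n <= i)%N -> x i = y i) ->
  Radon_Nikodym_cocycle nu x y =
  \prod_(i < n) (fine (nu i [set y i]) / fine (nu i [set x i])).
Proof.
move=> nu0 xy; apply: (@tail_fsbig 1 *%R
  (fun b c i => fine (nu i [set c]) / fine (nu i [set b]))) => //.
move=> b i; rewrite divff// gt_eqF// fine_gt0// nu0/=.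
by rewrite ltey_eq fin_num_measure.
Qed.

Lemma count_is_cocycle (a : R) : is_cocycle tail_equiv (count_cocycle a).
Proof.
move=> x y z [n _ xy] [m _ yz].
have xy' i : (maxn n m <= i)%N -> x i = y i by rewrite geq_max => /andP[/xy].
have yz' i : (maxn n m <= i)%N -> y i = z i by rewrite geq_max => /andP[_ /yz].
have xz' i : (maxn n m <= i)%N -> x i = z i by move=> /[dup]/xy'-> /yz'.
rewrite (count_cocycleE _ xy') (count_cocycleE _ yz') (count_cocycleE _ xz').
by rewrite -big_split/=; apply: eq_bigr => i _; ring.
Qed.

Lemma ln_Radon_Nikodym_is_cocycle nu : (forall i b, (0 < nu i [set b])%E) ->
  is_cocycle tail_equiv (fun x y => ln (Radon_Nikodym_cocycle nu x y)).
Proof.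
move=> nu0 x y z [n _ xy] [m _ yz].
have fnu0 i b : 0 < fine (nu i [set b]).
  by rewrite fine_gt0// nu0/= ltey_eq fin_num_measure.
have xy' i : (maxn n m <= i)%N -> x i = y i by rewrite geq_max => /andP[/xy].
have yz' i : (maxn n m <= i)%N -> y i = z i by rewrite geq_max => /andP[_ /yz].
have xz' i : (maxn n m <= i)%N -> x i = z i by move=> /[dup]/xy'-> /yz'.
rewrite (Radon_Nikodym_cocycleE nu0 xy') (Radon_Nikodym_cocycleE nu0 yz').
rewrite (Radon_Nikodym_cocycleE nu0 xz') -lnM ?posrE ?prodr_gt0//; last 2 first.
- by move=> i _; rewrite divr_gt0.
- by move=> i _; rewrite divr_gt0.
rewrite -big_split/=; congr ln; apply: eq_bigr => i _.
by rewrite [RHS]mulrC mulrA divfK// gt_eqF.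
Qed.

End cocycle_theory.

(* Main.v *)
Require Import Defs.
From HB Require Import structures.
From mathcomp Require Import all_boot all_order all_algebra.
From mathcomp Require Import all_classical all_reals all_analysis.
From mathcomp Require Import measurable_realfun ring lra.
Import Order.TTheory GRing.Theory Num.Theory.
Import numFieldNormedType.Exports.
Local Open Scope classical_set_scope.
Local Open Scope ring_scope.

Set Implicit Arguments.
Unset Strict Implicit.
Unset Printing Implicit Defensive.

(** Since alpha (x, y) = sum_i (y_i - x_i) eps_i, the conditional probability of
an invariant set A, given the first n coordinates of x and the real coordinate
t, is phi_n (t - sum_(i < n) x_i eps_i) for a function phi_n : R -> [0, 1], and
  phi_n (t) = (1 - p_n) phi_(n+1) (t) + p_n phi_(n+1) (t - eps_n),
with p_n = mu_n (1).  This is a bounded martingale.  Its increments are square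
summable: if E_n is the weighted L^2-norm squared of
phi_(n+1) - phi_(n+1) (. - eps_n), then sum_n p_n (1 - p_n) E_n < oo, whereas
sum_n eps_n ^ 2 = oo, so that E_n / eps_n ^ 2 is arbitrarily small along a
subsequence.  Iterating the shift by eps_n about s / eps_n times, the weighted
distance between phi_n and its translate by (about) s is at most
C (s / eps_n) ^ 2 E_n, and this distance is nondecreasing in n.  Hence phi_0 is
invariant under translations; likewise every phi_n integrates to k (b - a)
over any interval ]a, b], with k independent of n.  So A meets every
product of a cylinder and an interval in the proportion k; therefore
(mu x Leb) (A `&` X) = k (mu x Leb) (X) for all X, and X = ~` A, X = A show
that A is null or conull. *)

(** * Bounded measurable functions on the line *)

Section bounded_measurable.
Context {R : realType}.
Implicit Types f g : R -> R.

Definition bounded_measurable f :=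
  measurable_fun setT f /\ exists M, forall x, `|f x| <= M.

Lemma bounded_measurable_cst (c : R) : bounded_measurable (fun=> c).
Proof. by split; [exact: measurable_cst|exists `|c|]. Qed.

Lemma bounded_measurableD f g : bounded_measurable f -> bounded_measurable g ->
  bounded_measurable (fun x => f x + g x).
Proof.
move=> [mf [M fM]] [mg [N gN]]; split; first exact: measurable_funD.
by exists (M + N) => x; rewrite (le_trans (ler_normD _ _))// lerD.
Qed.

Lemma bounded_measurableM f g : bounded_measurable f -> bounded_measurable g ->
  bounded_measurable (fun x => f x * g x).
Proof.
move=> [mf [M fM]] [mg [N gN]]; split; first exact: measurable_funM.
by exists (M * N) => x; rewrite normrM ler_pM.
Qed.

Lemma bounded_measurableZ (k : R) f : bounded_measurable f ->
  bounded_measurable (fun x => k * f x).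
Proof. exact/bounded_measurableM/bounded_measurable_cst. Qed.

Lemma bounded_measurableB f g : bounded_measurable f -> bounded_measurable g ->
  bounded_measurable (fun x => f x - g x).
Proof.
move=> bf bg; under eq_fun do rewrite -mulN1r.
exact/bounded_measurableD/bounded_measurableZ.
Qed.

Lemma bounded_measurableX f n : bounded_measurable f ->
  bounded_measurable (fun x => f x ^+ n).
Proof.
move=> bf; elim: n => [|n IH].
  by under eq_fun do rewrite expr0; exact: bounded_measurable_cst.
by under eq_fun do rewrite exprS; exact: bounded_measurableM.
Qed.

Lemma bounded_measurable_shift (s : R) f : bounded_measurable f ->
  bounded_measurable (fun x => f (x - s)).
Proof.
move=> [mf [M fM]]; split; last by exists M.
by apply: (measurableT_comp mf); exact: measurable_funB.
Qed.

Lemma bounded_measurable_sum n (F : nat -> R -> R) :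
  (forall i, bounded_measurable (F i)) ->
  bounded_measurable (fun x => \sum_(i < n) F i x).
Proof.
move=> bF; elim: n => [|n IH].
  by under eq_fun do rewrite big_ord0; exact: bounded_measurable_cst.
by under eq_fun do rewrite big_ord_recr/=; exact: bounded_measurableD.
Qed.

End bounded_measurable.

(** * Two-point averages and quasi-invariant functionals *)

Section average.
Context {R : realType}.
Implicit Types (f g : R -> R) (I : (R -> R) -> R).

Definition average (p e : R) f : R -> R :=
  fun x => (1 - p) * f x + p * f (x - e).

Lemma bounded_measurable_average p e f :
  bounded_measurable f -> bounded_measurable (average p e f).
Proof.
move=> bf; apply: bounded_measurableD; apply: bounded_measurableZ => //.
exact: bounded_measurable_shift.
Qed.

(** The model is integration against a weight whose translates by at most [S] are dominated by [C]
    times itself. The abstract form puts the averaged functionals [iter_average] on the same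
    footing. *)
Record quasi_invariant (C S : R) I : Prop := QuasiInvariant {
  qiD : forall f g, bounded_measurable f -> bounded_measurable g ->
    I (fun x => f x + g x) = I f + I g ;
  qiZ : forall k f, bounded_measurable f -> I (fun x => k * f x) = k * I f ;
  qi_le : forall f g, bounded_measurable f -> bounded_measurable g ->
    (forall x, f x <= g x) -> I f <= I g ;
  qi_shift : forall s f, `|s| <= S -> bounded_measurable f ->
    (forall x, 0 <= f x) -> I (fun x => f (x - s)) <= C * I f }.

Lemma qi_ge0 C S I f : quasi_invariant C S I -> bounded_measurable f ->
  (forall x, 0 <= f x) -> 0 <= I f.
Proof.
move=> qI bf f0; have := qiZ qI 0 bf; rewrite mul0r => <-.
apply: (qi_le qI) => //; first exact: bounded_measurableZ.
by move=> x; rewrite mul0r.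
Qed.

Lemma qi_sum C S I n (F : nat -> R -> R) : quasi_invariant C S I ->
  (forall i, bounded_measurable (F i)) ->
  I (fun x => \sum_(i < n) F i x) = \sum_(i < n) I (F i).
Proof.
move=> qI bF; elim: n => [|n IH].
  rewrite big_ord0 -[RHS](mul0r (I (F 0%N))) -(qiZ qI)//.
  by congr I; apply/funext => x; rewrite big_ord0 mul0r.
rewrite big_ord_recr/= -IH -(qiD qI)//; last exact: bounded_measurable_sum.
by congr I; apply/funext => x; rewrite big_ord_recr.
Qed.

(** Averaging commutes with translations, so it costs nothing in [C] or [S]; this keeps the later
    estimates uniform in the number of steps. *)
Lemma quasi_invariant_average C S I p e : 0 <= p <= 1 ->
  quasi_invariant C S I -> quasi_invariant C S (fun f => I (average p e f)).
Proof.
move=> /andP[p0 p1] qI; split=> [f g bf bg|k f bf|f g bf bg fg|s f sS bf f0].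
- rewrite -(qiD qI); try exact: bounded_measurable_average.
  by congr I; apply/funext => x; rewrite /average; ring.
- rewrite -(qiZ qI); last exact: bounded_measurable_average.
  by congr I; apply/funext => x; rewrite /average; ring.
- apply: (qi_le qI); try exact: bounded_measurable_average.
  by move=> x; rewrite /average lerD// ler_wpM2l// subr_ge0.
- apply: le_trans (qi_shift qI sS (bounded_measurable_average p e bf) _).
    rewrite le_eqVlt; apply/orP; left; apply/eqP; congr I; apply/funext => x.
    by rewrite /average [in LHS]addrAC.
  by move=> x; rewrite addr_ge0// mulr_ge0// subr_ge0.
Qed.

(** The last average acts first: step m takes a function of level m + 1 down to level m, and [I] is
    applied at level 0. *)
Fixpoint iter_average I (p e : nat -> R) n : (R -> R) -> R :=
  if n is m.+1 then fun f => iter_average I p e m (average (p m) (e m) f)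
  else I.

Lemma quasi_invariant_iter C S I p e n : (forall n, 0 <= p n <= 1) ->
  quasi_invariant C S I -> quasi_invariant C S (iter_average I p e n).
Proof. by move=> p01 qI; elim: n => //= n; apply: quasi_invariant_average. Qed.

End average.

(** * Two inequalities for finite sums *)

(** Cauchy-Schwarz against the constant sequence 1. *)
Lemma sqr_sum_le {R : realFieldType} n (a : nat -> R) :
  (\sum_(i < n) a i) ^+ 2 <= n%:R * \sum_(i < n) a i ^+ 2.
Proof.
case: n => [|n]; first by rewrite !big_ord0 expr0n mul0r.
elim: n => [|n IH]; first by rewrite !big_ord1 mul1r.
rewrite big_ord_recr/= [in leRHS]big_ord_recr/=.
move: IH; set s := \sum_(i < _) _; set q := \sum_(i < _) _ => IH.
set b := a _; rewrite -[n.+2]addn1 natrD.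
have m0 : 0 < n.+1%:R :> R by [].
move: IH m0; set m := n.+1%:R => IH m0.
suff : 2 * s * b <= q + m * b ^+ 2 by nra.
(* The induction hypothesis is s ^ 2 <= m * q, so after multiplication by [m] the cross term is
   controlled by the square of s - m * b. *)
rewrite -(ler_pM2l m0).
have := sqr_ge0 (s - m * b); nra.
Qed.

(** If the inequality failed from [m] on, the bounded sums of [a] would bound those of [b], up to
    the first [m] terms. *)
Lemma exists_le_mul_of_sums {R : realType} (a b : nat -> R) (K d : R) :
  (forall N, \sum_(i < N) a i <= K) -> (forall i, 0 <= a i) ->
  (forall M : R, exists N, M <= \sum_(i < N) b i) ->
  0 < d -> forall m, exists2 n, (m <= n)%N & a n < d * b n.
Proof.
move=> aK a0 bM d0 m; apply: contrapT => noN.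
have ab n : (m <= n)%N -> d * b n <= a n.
  by move=> mn; rewrite leNgt; apply/negP => h; apply: noN; exists n.
(* Absolute values, because the first [m] terms of [b] may have either sign. *)
pose B := \sum_(i < m) d * `|b i| + K.
have [N] := bM ((B + 1) / d).
rewrite ler_pdivrMr// mulrC mulr_sumr; apply/negP; rewrite -ltNge.
rewrite (@le_lt_trans _ _ B) ?ltrDl//.
have bB i : d * b i <= (if (i < m)%N then d * `|b i| else 0) + a i.
  case: ltnP => [_|/ab]; last by rewrite add0r.
  by rewrite ler_wpDr// ler_wpM2l ?ler_norm// ltW.
apply: le_trans (ler_sum _ (fun (i : 'I_N) _ => bB i)) _.
rewrite big_split/= lerD//; last exact: aK.
rewrite -big_mkcond/=.
have db0 i : 0 <= d * `|b i| by rewrite mulr_ge0// ltW.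
case: (leqP N m) => [Nm|mN].
  rewrite -(big_mkord (fun i => (i < m)%N) (fun i => d * `|b i|)).
  rewrite -(big_mkord xpredT (fun i => d * `|b i|)) (@big_cat_nat _ _ _ N 0 m)//=.
  rewrite ler_wpDr//; first exact: sumr_ge0.
  rewrite big_nat_cond [leRHS]big_nat_cond le_eqVlt; apply/orP; left; apply/eqP.
  by apply: eq_bigl => i; rewrite leq0n/= andbT; case: ltnP => //= /leq_trans ->.
by rewrite -(big_ord_widen _ (fun i => d * `|b i|) (ltnW mN)).
Qed.

(** * Energy of the martingale, and shifts that almost preserve it *)

Section small_shifts.
Context {R : realType}.
Variables (C S : R) (I : (R -> R) -> R) (p e : nat -> R) (phi : nat -> R -> R).
Hypothesis qI : quasi_invariant C S I.
Hypothesis C0 : 0 <= C.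
Hypothesis p01 : forall n, 0 <= p n <= 1.
Hypothesis bphi : forall n, bounded_measurable (phi n).
Hypothesis phi01 : forall n x, 0 <= phi n x <= 1.
Hypothesis phiE : forall n, phi n = average (p n) (e n) (phi n.+1).

Let J := iter_average I p e.

Let qJ n : quasi_invariant C S (J n).
Proof. exact: quasi_invariant_iter. Qed.

(** From [phi n x], the martingale moves by p n * h n x with probability 1 - p n and by - (1 - p n)
    * h n x with probability p n. *)
Let h n x := phi n.+1 x - phi n.+1 (x - e n).

Let bh n : bounded_measurable (h n).
Proof. by apply: bounded_measurableB => //; exact: bounded_measurable_shift. Qed.

Let E n := J n (fun x => h n x ^+ 2).

Let E_ge0 n : 0 <= E n.
Proof.
apply: (qi_ge0 (qJ n)); first exact: bounded_measurableX.
by move=> x; exact: sqr_ge0.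
Qed.

(** Orthogonality of the increments: pointwise, p n * (1 - p n) * h n ^ 2 is the variance of a
    variable with two values at distance |h n|. *)
Let J_sqr n : J n.+1 (fun x => phi n.+1 x ^+ 2) =
  J n (fun x => phi n x ^+ 2) + p n * (1 - p n) * E n.
Proof.
rewrite /E -(qiZ (qJ n)); last exact: bounded_measurableX.
rewrite -(qiD (qJ n)); last 2 first.
- exact: bounded_measurableX.
- by apply: bounded_measurableZ; exact: bounded_measurableX.
rewrite /J /=; congr iter_average; apply/funext => x.
by rewrite (phiE n) /average /h; ring.
Qed.

Let J1 n : J n (fun=> 1) = I (fun=> 1).
Proof.
elim: n => //= n <-; rewrite /J/=; congr iter_average; apply/funext => x.
by rewrite /average; ring.
Qed.

(** [J_sqr] telescopes, the squares are at most 1, and every [J n] takes the same value on the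
    constant 1. *)
Lemma sum_energy_le N : \sum_(n < N) p n * (1 - p n) * E n <= I (fun=> 1).
Proof.
have -> : \sum_(n < N) p n * (1 - p n) * E n =
    J N (fun x => phi N x ^+ 2) - J 0 (fun x => phi 0%N x ^+ 2).
  elim: N => [|N IH]; first by rewrite big_ord0 subrr.
  by rewrite big_ord_recr/= IH J_sqr; ring.
rewrite -(J1 N) lerBlDr ler_wpDr//.
  apply: (qi_ge0 (qJ 0)); first exact: bounded_measurableX.
  by move=> x; exact: sqr_ge0.
apply: (qi_le (qJ N)); [exact: bounded_measurableX|exact: bounded_measurable_cst|].
by move=> x; have /andP[? ?] := phi01 N x; rewrite exprn_ile1.
Qed.

Let D n s := J n (fun x => (phi n x - phi n (x - s)) ^+ 2).

Let bD n s : bounded_measurable (fun x => (phi n x - phi n (x - s)) ^+ 2).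
Proof.
apply/bounded_measurableX/bounded_measurableB => //.
exact: bounded_measurable_shift.
Qed.

(** Convexity of the square: averaging before squaring can only give less. *)
Let D_nondecreasing n s : D 0 s <= D n s.
Proof.
elim: n => // n /le_trans; apply; rewrite /D /J /=.
apply: (qi_le (qJ n)) => //; first exact: bounded_measurable_average.
move=> x; rewrite (phiE n) /average /= [x - _ - _]addrAC.
set u := phi _ x; set v := phi _ (x - s); set u' := phi _ (x - _).
set v' := phi _ _; have /andP[p0 p1] := p01 n.
(* The gap in the convexity inequality is again a two-point variance. *)
rewrite -subr_ge0 (_ : _ - _ = p n * (1 - p n) * ((u - v) - (u' - v')) ^+ 2).
  by apply: mulr_ge0 (sqr_ge0 _); apply: mulr_ge0 => //; rewrite subr_ge0.
by rewrite /u /v /u' /v'; ring.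
Qed.

(** A shift by k steps telescopes into k translates of [h n]. Cauchy-Schwarz gives one factor k, the
    number of translates the other, and each translation costs [C]. *)
Let D_mul n k : k%:R * `|e n| <= S -> `|e n| <= S ->
  D n.+1 (k%:R * e n) <= k%:R ^+ 2 * (C * ((1 + C) * E n)).
Proof.
move=> keS eS.
have hk x : phi n.+1 x - phi n.+1 (x - k%:R * e n) =
    \sum_(j < k) h n (x - j%:R * e n).
  elim: (k) => [|m IH]; first by rewrite big_ord0 mul0r subr0 subrr.
  by rewrite big_ord_recr/= -IH /h -natr1 mulrDl mul1r opprD addrA; ring.
have bj j : bounded_measurable (fun x => h n (x - j%:R * e n) ^+ 2).
  by apply: bounded_measurableX; exact: bounded_measurable_shift.
have bh2 : bounded_measurable (fun x => h n x ^+ 2) by exact: bounded_measurableX.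
apply: (@le_trans _ _
    (k%:R * \sum_(j < k) J n.+1 (fun x => h n (x - j%:R * e n) ^+ 2))).
  rewrite -(qi_sum _ (qJ n.+1) bj) -(qiZ (qJ n.+1)); last first.
    apply: (bounded_measurable_sum k bj).
  apply: (qi_le (qJ n.+1)) => //.
    by apply: bounded_measurableZ; exact: (bounded_measurable_sum k bj).
  move=> x; rewrite hk; exact: (sqr_sum_le _ (fun j => h n (x - j%:R * e n))).
rewrite expr2 -mulrA ler_wpM2l//.
rewrite [leRHS]mulr_natl -[k in leRHS]card_ord -sumr_const; apply: ler_sum => j _.
apply: (@le_trans _ _ (C * J n.+1 (fun x => h n x ^+ 2))).
  apply: (@qi_shift _ _ _ _ (qJ n.+1) (j%:R * e n) (fun x => h n x ^+ 2)) => //.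
    rewrite (le_trans _ keS)// normrM normr_nat ler_wpM2r// ler_nat.
    by rewrite ltnW// ltn_ord.
  by move=> x; exact: sqr_ge0.
(* [J n.+1] is [J n] of an average of [h n] squared and its translate by [e n]; the translate costs
   [C], whence 1 + C. *)
rewrite ler_wpM2l// /J/= mulrDl mul1r -/J.
have bhe : bounded_measurable (fun x => h n (x - e n) ^+ 2).
  by apply: bounded_measurableX; exact: bounded_measurable_shift.
have /andP[p0 p1] := p01 n.
have := @qi_shift _ _ _ _ (qJ n) (e n) (fun x => h n x ^+ 2) eS bh2
  (fun x => sqr_ge0 _).
rewrite /average (qiD (qJ n)); try exact: bounded_measurableZ.
rewrite !(qiZ (qJ n))// -/(E n).
have := qi_ge0 (qJ n) bhe (fun x => sqr_ge0 _); have := E_ge0 n.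
rewrite -/(J n) -/(E n); set a := J n _; set b := E n; nra.
Qed.

(** The squared difference for - s is the one for s, translated by - s. *)
Let D_opp s : `|s| <= S -> D 0 (- s) <= C * D 0 s.
Proof.
move=> sS; rewrite -normrN in sS.
apply: le_trans (qi_shift qI sS (bD 0 s) _); last first.
  by move=> x; exact: sqr_ge0.
rewrite le_eqVlt; apply/orP; left; apply/eqP; rewrite /D /J/=; congr I.
by apply/funext => x; rewrite opprK addrK -opprB sqrrN.
Qed.

(** The bound [c] makes the energies [E n] themselves summable, so [E n] is far below the square of
    [e n] for some large n; the shift s' is an integer multiple of that [e n]. *)
Lemma exists_small_shift (c s d : R) : 0 < c ->
  (forall n, c <= p n * (1 - p n)) -> e @ \oo --> 0 ->
  (forall M : R, exists N, M <= \sum_(i < N) e i ^+ 2) ->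
  0 < d -> `|s| <= S -> exists2 s', `|s' - s| < d &
    I (fun x => (phi 0%N x - phi 0%N (x - s')) ^+ 2) < d.
Proof.
move=> c0 cp e0 eoo d0 sS.
have [->|sn0] := eqVneq s 0.
  exists 0; first by rewrite subrr normr0.
  rewrite (_ : (fun x => _) = fun x => 0 * 1).
    by rewrite (qiZ qI) ?mul0r//; exact: bounded_measurable_cst.
  by apply/funext => x; rewrite subr0 subrr expr0n mul0r.
have S0 : 0 < S by rewrite (lt_le_trans _ sS)// normr_gt0.
(* Chosen so that (1 + C) ^ 3 * s ^ 2 * d' < d; the summand 1 makes this strict. *)
pose d' := d / ((1 + C) ^+ 3 * (s ^+ 2 + 1)).
have C1 : 0 < (1 + C) ^+ 3 * (s ^+ 2 + 1).
  apply: mulr_gt0; first by rewrite exprn_gt0// ltr_wpDr.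
  by rewrite ltr_wpDl ?sqr_ge0.
have d'0 : 0 < d' by rewrite divr_gt0.
have sumE N : \sum_(n < N) E n <= I (fun=> 1) / c.
  rewrite ler_pdivlMr// mulrC; apply: le_trans (sum_energy_le N).
  by rewrite mulr_sumr; apply: ler_sum => n _; rewrite ler_wpM2r.
(* From [m] on, a step is shorter than the precision [d] and than [S], the range in which
   translations are controlled. *)
have [m em] : exists m, forall n, (m <= n)%N -> `|e n| < Num.min d S.
  have dS : 0 < Num.min d S by rewrite lt_min d0 S0.
  move/cvgrPdist_lt : e0 => /(_ _ dS) [m _ em]; exists m => n /em /=.
  by rewrite sub0r normrN.
have [n mn En] :=
  exists_le_mul_of_sums (b := fun i => e i ^+ 2) sumE E_ge0 eoo d'0 m.
have := em n mn; rewrite lt_min => /andP[ed eS].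
(* The strict inequality [En] rules out a vanishing step. *)
have en0 : 0 < `|e n|.
  rewrite normr_gt0; apply/eqP => en0; move: En.
  by rewrite en0 expr0n mulr0 ltNge E_ge0.
(* The number [k] counts the whole steps that fit into |s|. *)
have := truncn_itv (divr_ge0 (normr_ge0 s) (normr_ge0 (e n))).
set k := Num.truncn _; rewrite ler_pdivlMr// ltr_pdivrMr// -natr1 => /andP[k1 k2].
(* The factor 1 + C serves both signs below: s' = k * e n needs the factor 1, and s' = - (k * e n)
   needs [C]. *)
have Dk : (1 + C) * D 0 (k%:R * e n) < d.
  apply: (@le_lt_trans _ _ ((1 + C) * (k%:R ^+ 2 * (C * ((1 + C) * E n))))).
    rewrite ler_wpM2l ?addr_ge0// (le_trans (D_nondecreasing n.+1 _))// D_mul//.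
      exact: le_trans sS.
    exact: ltW.
  have -> : d = (1 + C) ^+ 3 * (s ^+ 2 + 1) * d' by rewrite mulrC divfK ?gt_eqF.
  have ks : k%:R ^+ 2 * e n ^+ 2 <= s ^+ 2.
    rewrite -exprMn -(real_normK (num_real s)) -[leLHS]real_normK ?num_real//.
    rewrite normrM normr_nat.
    by rewrite ler_sqr ?nnegrE ?mulr_ge0.
  have kE : k%:R ^+ 2 * E n <= s ^+ 2 * d'.
    apply: (@le_trans _ _ (k%:R ^+ 2 * (d' * e n ^+ 2))).
      by rewrite ler_wpM2l ?exprn_ge0// ltW.
    by rewrite [d' * _]mulrC mulrA ler_wpM2r// ltW.
  have kE0 : 0 <= k%:R ^+ 2 * E n by rewrite mulr_ge0 ?exprn_ge0.
  rewrite (_ : (1 + C) * _ = (1 + C) ^+ 2 * C * (k%:R ^+ 2 * E n)); last by ring.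
  apply: (@le_lt_trans _ _ ((1 + C) ^+ 3 * (s ^+ 2 * d'))).
    rewrite ler_pM ?mulr_ge0 ?exprn_ge0 ?addr_ge0//.
    by rewrite [leRHS]exprSr ler_wpM2l ?exprn_ge0 ?addr_ge0// lerDr.
  by rewrite -mulrA ltr_pM2l ?exprn_gt0 ?ltr_wpDr// mulrDl mul1r ltrDl.
have D0 : 0 <= D 0 (k%:R * e n).
  by apply: (qi_ge0 qI) => // x; exact: sqr_ge0.
have [es|es] := leP 0 (e n * s).
  exists (k%:R * e n); last first.
    by apply: le_lt_trans Dk; rewrite -[leLHS]mul1r ler_wpM2r// lerDl.
  apply: le_lt_trans ed; move: es k1 k2.
  by case: (ger0P s) => s0; case: (ger0P (e n)) => e1 es k1 k2;
    rewrite ler_norml; nra.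
exists (- (k%:R * e n)); last first.
  apply: le_lt_trans Dk; apply: (@le_trans _ _ (C * D 0 (k%:R * e n))).
    by apply: D_opp; rewrite normrM normr_nat (le_trans k1).
  by rewrite ler_wpM2r// lerDr.
apply: le_lt_trans ed; move: es k1 k2.
by case: (ger0P s) => s0; case: (ger0P (e n)) => e1 es k1 k2; rewrite ler_norml; nra.
Qed.

End small_shifts.

(** * Translation invariance of Lebesgue measure *)

Section shift.
Context {R : realType}.
Notation leb := (@lebesgue_measure R).

Let mshift (s : R) : measurable_fun [set: measurableTypeR R]
  (fun x : measurableTypeR R => x - s : measurableTypeR R).
Proof. exact: measurable_funB. Qed.

(** Uniqueness of Lebesgue measure reduces this to half-open intervals. *)
Lemma lebesgue_measure_shift (s : R) (A : set (measurableTypeR R)) :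
  measurable A -> pushforward leb (fun x : R => x - s : measurableTypeR R) A = leb A.
Proof.
move=> mA; pose m : {measure set (measurableTypeR R) -> \bar R} :=
  measure_function_pushforward__canonical__measure_function_Measure leb (mshift s).
apply/esym/(@lebesgue_measure_unique R m) => // _ [[a b] _ <-].
rewrite /m/= /pushforward (_ : _ @^-1` _ = `]a + s, b + s]%classic).
  rewrite !lebesgue_measure_itv/= !lte_fin ltrD2r -!EFinB.
  by rewrite opprD addrACA subrr addr0.
by apply/seteqP; split => x/=; rewrite !in_itv/= ltrBrDr lerBlDr.
Qed.

Lemma ge0_integral_shift (s : R) (D : set (measurableTypeR R)) (f : R -> \bar R) :
  measurable D -> measurable_fun setT f -> (forall x, 0 <= f x)%E ->
  (\int[leb]_(x in (fun x : R => x - s)%R @^-1` D) f (x - s)%R =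
   \int[leb]_(x in D) f x)%E.
Proof.
move=> mD mf f0.
pose m : {measure set (measurableTypeR R) -> \bar R} :=
  measure_function_pushforward__canonical__measure_function_Measure leb (mshift s).
transitivity (\int[m]_(x in D) f x)%E.
  by rewrite ge0_integral_pushforward//; exact: measurable_funS mf.
apply: eq_measure_integral => A mA _; exact: lebesgue_measure_shift.
Qed.

End shift.

(** * The weight 1 / (1 + x ^ 2) *)

Section oneDsqr_integral.
Context {R : realType}.
Notation leb := (@lebesgue_measure R).
Implicit Types f g : R -> R.

Lemma integrable_oneDsqrV : leb.-integrable setT (fun x => (oneDsqr x)^-1%:E).
Proof.
have cf : continuous (fun x : R => (oneDsqr x)^-1) := continuous_oneDsqrV.
apply/integrableP; split.
  by apply/measurable_EFinP; exact: (continuous_measurable_fun cf).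
under eq_integral do rewrite gee0_abs ?lee_fin ?invr_ge0//.
rewrite ge0_symfun_integralT//; last first.
- by move=> x; rewrite /oneDsqr/= sqrrN.
by rewrite -set_itvcy integral0y_oneDsqr -EFinM ltry.
Qed.

Lemma integrable_div_oneDsqr f : bounded_measurable f ->
  leb.-integrable setT (fun x => (f x / oneDsqr x)%:E).
Proof.
move=> [mf [M fM]].
apply: (@integrableMr _ _ _ leb _ measurableT f (fun x => (oneDsqr x)^-1%:E)) => //.
  exists M; split; first exact: num_real.
  by move=> y My x _ /=; rewrite (le_trans (fM x))// ltW.
exact: integrable_oneDsqrV.
Qed.

(* The weight is integrable and bounded shifts change it by bounded factors. *)
Definition weighted_integral f : R := \int[leb]_x (f x / oneDsqr x).

Lemma oneDsqr_shift (s S x : R) : `|s| <= S ->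
  oneDsqr x <= 2 * oneDsqr S * oneDsqr (x + s).
Proof.
rewrite ler_norml /oneDsqr => sS.
have sS2 : s ^+ 2 <= S ^+ 2 by nra.
(* Nonnegativity of (x + 2 * s) ^ 2 says that x ^ 2 <= 2 * (x + s) ^ 2 + 2 * s ^ 2. *)
have := sqr_ge0 (x + 2 * s); have := sqr_ge0 (S * (x + s)); nra.
Qed.

(** For the translation bound, a change of variables moves the shift from [f] to the weight, where
    [oneDsqr_shift] applies. *)
Lemma quasi_invariant_weighted_integral (S : R) :
  quasi_invariant (2 * oneDsqr S) S weighted_integral.
Proof.
rewrite /weighted_integral; split => [f g bf bg|k f bf|f g bf bg fg|s f sS bf f0].
- rewrite -RintegralD//; try exact: integrable_div_oneDsqr.
  by under eq_Rintegral do rewrite mulrDl.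
- rewrite -RintegralZl//; try exact: integrable_div_oneDsqr.
  by under eq_Rintegral do rewrite -mulrA.
- apply: le_Rintegral; rewrite //=; try exact: integrable_div_oneDsqr.
  by move=> x _; rewrite ler_wpM2r// invr_ge0.
have bfs := bounded_measurable_shift s bf.
have mw : measurable_fun setT (fun x : R => (oneDsqr x)^-1).
  by apply: continuous_measurable_fun; exact: continuous_oneDsqrV.
have mws : measurable_fun setT (fun x : R => (oneDsqr (x + s))^-1).
  by apply: (measurableT_comp mw); exact: measurable_funD.
have w0 x : 0 <= (oneDsqr x)^-1 :> R by rewrite invr_ge0.
have -> : \int[leb]_x (f (x - s) / oneDsqr x) =
    \int[leb]_x (f x / oneDsqr (x + s)).
  rewrite /Rintegral.
  rewrite -(@ge0_integral_shift _ s _ (fun x => (f x / oneDsqr (x + s))%:E))//.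
  - by rewrite preimage_setT; under [in RHS]eq_integral do rewrite subrK.
  - by apply/measurable_EFinP/measurable_funM => //; case: bf.
  - by move=> x; rewrite lee_fin mulr_ge0.
have iw := integrable_div_oneDsqr bf.
have wle x : f x / oneDsqr (x + s) <= 2 * oneDsqr S * (f x / oneDsqr x).
  rewrite mulrCA ler_wpM2l// ler_pdivlMr// mulrC ler_pdivrMr//.
  exact: oneDsqr_shift.
rewrite -RintegralZl//; apply: le_Rintegral => //=.
- apply: le_integrable (integrableZl measurableT (2 * oneDsqr S) iw) => //.
    by apply/measurable_EFinP/measurable_funM => //; case: bf.
  move=> x _ /=; by rewrite lee_fin !ger0_norm ?mulr_ge0.
- exact: (integrableZl measurableT (2 * oneDsqr S) iw).
Qed.

End oneDsqr_integral.

(** * Additive functions of intervals *)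

(** The bounds by the length make [V] continuous in the end points, so approximate shifts can be
    replaced by exact ones. Then [V] depends on the length only, additively and monotonically, hence
    linearly. *)
Lemma linear_of_almost_shift_invariant {R : realType} (V : R -> R -> R) :
  (forall a b c, a <= b -> b <= c -> V a c = V a b + V b c) ->
  (forall a b, a <= b -> 0 <= V a b <= b - a) ->
  (forall a b s d, a <= b -> 0 < d -> exists2 s', `|s' - s| < d &
    `|V (a - s') (b - s') - V a b| <= d) ->
  exists c, forall a b, a <= b -> V a b = c * (b - a).
Proof.
move=> VD V01 Vs.
have V_le a b a' b' : a <= b -> a' <= a -> b <= b' ->
    V a b <= V a' b' <= V a b + (a - a') + (b' - b).
  move=> ab aa bb; rewrite (VD a' a b')// ?(le_trans ab)// (VD a b b')//.
  have /andP[? ?] := V01 _ _ aa; have /andP[? ?] := V01 _ _ bb.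
  by apply/andP; split; lra.
have V_shift a b s : a <= b -> V (a - s) (b - s) = V a b.
  move=> ab; apply/eqP; rewrite -subr_eq0 -normr_le0; apply/ler_addgt0Pr => d d0.
  have d30 : 0 < d / 3 by rewrite divr_gt0.
  have [s' ss' Vs'] := Vs a b s _ ab d30.
  (* Both intervals lie in the one from a - s' - d / 3 to b - s' + d / 3, which exceeds the second
     by d / 3 at each end. *)
  have h1 : V (a - s) (b - s) <= V (a - s') (b - s') + 2 * (d / 3).
    move: ss'; rewrite ltr_norml => ss'.
    have := @V_le (a - s) (b - s) (a - s' - d / 3) (b - s' + d / 3).
    have := @V_le (a - s') (b - s') (a - s' - d / 3) (b - s' + d / 3).
    by do 2 (move=> /(_ ltac:(lra) ltac:(lra) ltac:(lra)) /andP[? ?]); lra.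
  have h2 : V (a - s') (b - s') <= V (a - s) (b - s) + 2 * (d / 3).
    move: ss'; rewrite ltr_norml => ss'.
    have := @V_le (a - s') (b - s') (a - s - d / 3) (b - s + d / 3).
    have := @V_le (a - s) (b - s) (a - s - d / 3) (b - s + d / 3).
    by do 2 (move=> /(_ ltac:(lra) ltac:(lra) ltac:(lra)) /andP[? ?]); lra.
  by move: Vs'; rewrite !ler_norml; lra.
pose v u := V 0 u.
have VE a b : a <= b -> V a b = v (b - a).
  by move=> ab; rewrite -(@V_shift a b a)// subrr.
have vD u w : 0 <= u -> 0 <= w -> v (u + w) = v u + v w.
  move=> u0 w0; rewrite /v (VD 0 u)// ?lerDl//; congr (_ + _).
  by rewrite VE ?lerDl// [u + w]addrC addrK.
have v0 : v 0 = 0 by have := V01 0 0 (lexx _); rewrite /v; lra.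
have vn n u : 0 <= u -> v (n%:R * u) = n%:R * v u.
  move=> u0; elim: n => [|n IH]; first by rewrite !mul0r.
  by rewrite -natr1 !mulrDl vD ?mulr_ge0// ?mul1r// IH.
have v_le u w : 0 <= u -> u <= w -> v u <= v w.
  by move=> u0 uw; have /andP[] := V_le 0 u 0 w u0 (lexx _) uw.
exists (v 1) => a b ab; rewrite VE//; set u := b - a.
have u0 : 0 <= u by rewrite subr_ge0.
have v11 : 0 <= v 1 <= 1 by have := V01 0 1 ler01; rewrite subr0.
(* If k <= n * u < k + 1, then n * v u and n * u * v 1 both lie between k * v 1 and (k + 1) * v
   1. *)
have nvu n : `|n%:R * (v u - v 1 * u)| <= 1.
  have nu0 : 0 <= n%:R * u by rewrite mulr_ge0.
  have /andP[k1 k2] := truncn_itv nu0; set k := Num.truncn _ in k1 k2.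
  have := v_le _ _ (ler0n _ k) k1; have := v_le _ _ nu0 (ltW k2).
  rewrite vn// -[k.+1%:R]mulr1 -[k%:R]mulr1 !vn// -natr1 => h1 h2.
  rewrite -natr1 in k2.
  have {}k1 : k%:R * v 1 <= n%:R * u * v 1 by rewrite ler_wpM2r//; lra.
  have {}k2 : n%:R * u * v 1 <= (k%:R + 1) * v 1.
    by rewrite ler_wpM2r//; lra.
  rewrite ler_norml; lra.
apply/eqP; rewrite -subr_eq0; apply/negP => /negP neq0.
have eta0 : 0 < `|v u - v 1 * u| by rewrite normr_gt0.
pose n := (Num.truncn (`|v u - v 1 * u|^-1)).+1.
have := nvu n; rewrite normrM normr_nat -ler_pdivlMr// div1r leNgt.
by rewrite /n truncnS_gt.
Qed.

(** * Integrals over bounded intervals *)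

Section window.
Context {R : realType}.
Notation leb := (@lebesgue_measure R).
Implicit Types f : R -> R.

Lemma integrable_itvoc f a b : bounded_measurable f ->
  leb.-integrable `]a, b] (fun x => (f x)%:E).
Proof.
move=> [mf [M fM]]; apply: measurable_bounded_integrable => //.
- by rewrite /= lebesgue_measure_itv/=; case: ifPn => //; rewrite -EFinB ltry.
- exact: measurable_funTS.
- exists M; split; first exact: num_real.
  by move=> y My x _ /=; rewrite (le_trans (fM x))// ltW.
Qed.

(** Half-open intervals concatenate without overlap and generate the Borel sets. *)
Definition window f a b : R := \int[leb]_(x in `]a, b]) f x.

Lemma windowD f a b c : bounded_measurable f -> a <= b -> b <= c ->
  window f a c = window f a b + window f b c.
Proof.
move=> bf ab bc; rewrite /window.
have abcE : [set` `]a, c]] = `]a, b]%classic `|` `]b, c]%classic.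
  by rewrite (@itv_bndbnd_setU _ _ (BRight a) (BRight b) (BRight c)).
rewrite abcE; apply: Rintegral_setU => //=.
  by rewrite -abcE; exact: integrable_itvoc.
apply/disj_setPS => x /= []; rewrite !in_itv/= => /andP[_ xb] /andP[].
by rewrite ltNge xb.
Qed.

Lemma window_cst (k a b : R) : a <= b -> window (fun=> k) a b = k * (b - a).
Proof.
move=> ab; rewrite /window Rintegral_cst//= lebesgue_measure_itv/= lte_fin.
case: ifPn => [_|]; first by rewrite -EFinB.
by rewrite -leNgt => ba; rewrite (le_anti (introT andP (conj ab ba))) subrr.
Qed.

Lemma window_le f g a b : bounded_measurable f -> bounded_measurable g ->
  (forall x, a < x -> x <= b -> f x <= g x) -> window f a b <= window g a b.
Proof.
move=> bf bg fg; apply: le_Rintegral; rewrite //=; try exact: integrable_itvoc.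
by move=> x; rewrite /= in_itv/= => /andP[? ?]; exact: fg.
Qed.

Lemma window_shift f a b s : bounded_measurable f -> (forall x, 0 <= f x) ->
  window (fun x => f (x - s)) a b = window f (a - s) (b - s).
Proof.
move=> [mf _] f0; rewrite /window /Rintegral; congr fine.
rewrite -(@ge0_integral_shift _ s _ (fun x => (f x)%:E))//.
- congr (integral _ _ _); apply/seteqP; split => x /=;
    by rewrite !in_itv/= ltrD2r lerD2r.
- exact/measurable_EFinP.
Qed.

(** On ]a, b] one has |x| <= |a| + |b|, which bounds the weight from below. *)
Lemma window_le_weighted_integral f a b : bounded_measurable f ->
  (forall x, 0 <= f x) ->
  window f a b <= oneDsqr (`|a| + `|b|) * weighted_integral f.
Proof.
move=> bf f0; have iw := integrable_div_oneDsqr bf.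
have iM := integrableZl measurableT (oneDsqr (`|a| + `|b|)) iw.
have mf : measurable_fun setT f by case: bf.
have mM : measurable_fun setT (fun x => oneDsqr (`|a| + `|b|) * (f x / oneDsqr x)).
  by have /measurable_int/measurable_EFinP := iM.
have M0 x : 0 <= oneDsqr (`|a| + `|b|) * (f x / oneDsqr x) by rewrite !mulr_ge0.
rewrite /window /weighted_integral -RintegralZl//.
apply: (@le_trans _ _
  (\int[leb]_(x in `]a, b]) (oneDsqr (`|a| + `|b|) * (f x / oneDsqr x)))).
  apply: le_Rintegral; rewrite //=; first exact: integrable_itvoc.
    exact: integrableS iM.
  move=> x; rewrite /= in_itv/= => /andP[ax xb].
  rewrite mulrCA ler_peMr// ler_pdivlMr// mul1r /oneDsqr lerD2l.
  rewrite -[leLHS]real_normK ?num_real// ler_sqr ?nnegrE ?addr_ge0//.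
  rewrite ler_norml; move: ax xb.
  by case: (ger0P a) => a0; case: (ger0P b) => b0 ax xb; lra.
rewrite /Rintegral fine_le//.
- exact: (integrable_fin_num _ (integrableS _ _ _ iM)).
- exact: (integrable_fin_num _ iM).
- apply: ge0_subset_integral => //=; first exact/measurable_EFinP.
  by move=> x _; rewrite lee_fin.
Qed.

(** Weighted L^2-closeness of [f] to its translate makes their integrals over ]a, b] close, as
    [linear_of_almost_shift_invariant] requires. *)
Lemma window_linear f : bounded_measurable f -> (forall x, 0 <= f x <= 1) ->
  (forall s d, 0 < d -> exists2 s', `|s' - s| < d &
    weighted_integral (fun x => (f x - f (x - s')) ^+ 2) < d) ->
  exists c, forall a b, a <= b -> window f a b = c * (b - a).
Proof.
move=> bf f01 fs.
have f0 x : 0 <= f x by have /andP[] := f01 x.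
apply: linear_of_almost_shift_invariant => [a b c|a b ab|a b s d ab d0].
- exact: windowD.
- apply/andP; split.
    rewrite -(mul0r (b - a)) -window_cst//; apply: window_le => //.
    exact: bounded_measurable_cst.
  rewrite -(mul1r (b - a)) -window_cst//; apply: window_le => //.
    exact: bounded_measurable_cst.
  by move=> x _ _; have /andP[] := f01 x.
pose M := oneDsqr (`|a| + `|b|); have M0 : 0 < M by rewrite /M.
(* The parameter of the AM-GM inequality below: eta * (b - a) is at most d / 2, and the summand 1
   covers a = b. *)
pose eta := d / (2 * (b - a + 1)).
have ba0 : 0 < b - a + 1 by lra.
have eta0 : 0 < eta by rewrite divr_gt0// mulr_gt0.
(* The second bound makes the quadratic term, which carries the factor M / eta, contribute at most d
   / 2. *)
have d0' : 0 < Num.min d (d * eta / (2 * M)).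
  by rewrite lt_min d0/=; apply: divr_gt0; exact: mulr_gt0.
have [s'] := fs s _ d0'; rewrite lt_min => /andP[ss' _].
rewrite lt_min => /andP[_ ws'].
exists s' => //; rewrite -window_shift//.
have bfs := bounded_measurable_shift s' bf.
have bq : bounded_measurable (fun x => (f x - f (x - s')) ^+ 2).
  exact/bounded_measurableX/bounded_measurableB.
have bb : bounded_measurable (fun x => eta + eta^-1 * (f x - f (x - s')) ^+ 2).
  apply: bounded_measurableD; first exact: bounded_measurable_cst.
  exact: bounded_measurableZ.
rewrite /window -RintegralB//=; try exact: integrable_itvoc.
apply: le_trans (le_normr_Rintegral _ _) _; rewrite //=.
  by apply: integrable_itvoc; exact: bounded_measurableB.
(* AM-GM: |y| <= eta + y ^ 2 / eta *)
apply: (@le_trans _ _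
    (window (fun x => eta + eta^-1 * (f x - f (x - s')) ^+ 2) a b)).
  apply: window_le => //.
    split; last first.
      exists 2 => x; rewrite normr_id ler_norml.
      by have := f01 x; have := f01 (x - s'); lra.
    apply: measurableT_comp => //.
    by have [] := bounded_measurableB bfs bf.
  move=> x _ _; rewrite distrC -(ler_pM2l eta0) mulrDr.
  rewrite [eta * (eta^-1 * _)]mulrA divff ?gt_eqF// mul1r.
  rewrite -[X in _ <= _ + X]real_normK ?num_real//.
  have := normr_ge0 (f x - f (x - s')); set y := `|_|; nra.
apply: (@le_trans _ _ (eta * (b - a) + eta^-1 *
    window (fun x => (f x - f (x - s')) ^+ 2) a b)).
  rewrite -window_cst// /window -RintegralZl//=; last exact: integrable_itvoc.
  rewrite -RintegralD//=; first exact: integrable_itvoc (bounded_measurable_cst _).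
  by apply: integrable_itvoc; exact: bounded_measurableZ.
have wM := window_le_weighted_integral a b bq (fun x => sqr_ge0 _).
have -> : d = d / 2 + eta^-1 * (M * (d * eta / (2 * M))).
  by field; rewrite !gt_eqF//.
apply: lerD.
  rewrite /eta; apply: (@le_trans _ _ (d / (2 * (b - a + 1)) * (b - a + 1))).
    by rewrite ler_wpM2l//; [exact: ltW|lra].
  by rewrite invfM mulrA divfK ?gt_eqF.
rewrite ler_pM2l ?invr_gt0//; apply: le_trans wM _.
by rewrite ler_pM2l// ltW.
Qed.

End window.

(** * Cylinders, and the product measure conditioned on them *)

Definition cylinder (w : nat -> bool) n := box n (fun i => [set w i]).

(** The image of a product measure under [graft w n] is that measure conditioned on [cylinder w n],
    if the cylinder has positive measure; see [measure_cylinderI]. *)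
Definition graft (w : nat -> bool) n (x : binseq) : binseq :=
  fun i => if (i < n)%N then w i else x i.

Lemma preimage_graft_box w n m A : graft w n @^-1` box m A =
  box m (fun i => if (i < n)%N then [set b | A i (w i)] else A i).
Proof.
by apply/seteqP; split => x h i /h; rewrite /graft; case: ltnP.
Qed.

Lemma measurable_graft w n : measurable_fun [set: binseq] (graft w n).
Proof.
apply: (measurability boxes); first exact: measurable_binseqE.
move=> _ [_ [m [A ->]] <-]; rewrite setTI preimage_graft_box.
exact: measurable_box.
Qed.

Lemma box_widen n m A : (n <= m)%N ->
  box n A = box m (fun i => if (i < n)%N then A i else setT).
Proof.
move=> nm; apply/seteqP; split => x h i im.
  by case: ltnP => // /h.
by have := h i (leq_trans im nm); rewrite im.
Qed.

Lemma boxI n A B : box n A `&` box n B = box n (fun i => A i `&` B i).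
Proof.
apply/seteqP; split => [x [xA xB] i ni|x xAB].
  by split; [exact: xA|exact: xB].
by split => i /xAB [].
Qed.

(** The empty set is included for closure under intersection. *)
Definition cylinders : set (set binseq) :=
  [set B | B = set0 \/ exists w n, B = cylinder w n].

(** Two cylinders are nested or disjoint, according to whether the longer word extends the shorter
    one. *)
Lemma setI_closed_cylinders : setI_closed cylinders.
Proof.
have cap w n w' n' : (n <= n')%N -> cylinders (cylinder w n `&` cylinder w' n').
  move=> nn'; have [ww'|] := pselect (forall i, (i < n)%N -> w' i = w i).
    right; exists w', n'; apply/seteqP; split => [x []//|x xw']; split => // i ni.
    by rewrite /= -ww'//; exact: xw' (leq_trans ni nn').
  move=> /existsNP[i /not_implyP[ni ww']]; left.
  apply/seteqP; split => // x [xw xw']; apply: ww'.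
  by rewrite -(xw _ ni) (xw' i (leq_trans ni nn')).
move=> _ _ [->|[w [n ->]]] [->|[w' [n' ->]]].
- by left; rewrite set0I.
- by left; rewrite set0I.
- by left; rewrite setI0.
- by have [/cap//|/ltnW nn'] := leqP n n'; rewrite setIC; exact: cap.
Qed.

(** A box is the finite union of the cylinders of the words that it admits. *)
Lemma measurable_cylinderE : @measurable _ binseq = <<s cylinders >>.
Proof.
apply/seteqP; split; last first.
  apply: smallest_sub; first exact: sigma_algebra_measurable.
  by move=> _ [->|[w [n ->]]]; [exact: measurable0|exact: measurable_box].
rewrite measurable_binseqE.
apply: smallest_sub; first exact: smallest_sigma_algebra.
move=> _ [n [A ->]].
rewrite (_ : box n A = \bigcup_(w in [set w : n.-tuple bool |
    forall i, (i < n)%N -> A i (nth false w i)]) cylinder (nth false w) n).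
  rewrite bigcup_mkcond.
  apply: (@countable_bigcupT_measurable _ (g_sigma_algebraType cylinders)).
    exact: countableP.
  move=> w; case: ifPn => _; last exact: (@measurable0 _ (g_sigma_algebraType _)).
  by apply: sub_sigma_algebra; right; exists (nth false w), n.
apply/seteqP; split => [x Ax|x [w /= Aw xw] i ni];
  last by rewrite (xw i ni)/=; exact: Aw.
have wE i : (i < n)%N -> nth false (mktuple (fun i : 'I_n => x i)) i = x i.
  by move=> ni; rewrite (nth_mktuple _ _ (Ordinal ni)).
by exists (mktuple (fun i : 'I_n => x i)) => i ni /=; rewrite wE//; exact: Ax.
Qed.

Section cylinder_measure.
Context {R : realType}.

Lemma measure_unique_cylinder (m1 m2 : {measure set binseq -> \bar R}) :
  (m1 setT < +oo)%E -> (forall w n, m1 (cylinder w n) = m2 (cylinder w n)) ->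
  forall A, measurable A -> m1 A = m2 A.
Proof.
move=> m1oo m12 A mA; apply: (measure_unique cylinders (fun=> setT)) => //.
- exact: measurable_cylinderE.
- exact: setI_closed_cylinders.
- by move=> _; right; exists (fun=> false), 0%N; apply/seteqP; split.
- by rewrite bigcup_const.
- by move=> _ [->|[w [n ->]]]; rewrite ?measure0.
Qed.

Variables (nu : nat -> probability bool R) (mu : probability binseq R).
Hypothesis mu_nu : is_product_measure nu mu.

Lemma measure_cylinder w n :
  mu (cylinder w n) = (\prod_(i < n) fine (nu i [set w i]))%:E.
Proof.
rewrite mu_nu -prodEFin; apply: eq_bigr => i _.
by rewrite fineK// fin_num_measure.
Qed.

(** Independence of the first [n] coordinates from the others. Both sides are finite measures in
    [B], so boxes suffice, and there the identity holds coordinate by coordinate. *)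
Lemma measure_cylinderI w n (B : set binseq) : measurable B ->
  mu (cylinder w n `&` B) = (mu (cylinder w n) * mu (graft w n @^-1` B))%E.
Proof.
move=> mB; have mC : measurable (cylinder w n) by exact: measurable_box.
pose r : {nonneg R} := NngNum (fine_ge0 (measure_ge0 mu (cylinder w n))).
pose m1 : {measure set binseq -> \bar R} := mrestr mu mC.
pose mg : {measure set binseq -> \bar R} :=
  measure_function_pushforward__canonical__measure_function_Measure mu
    (measurable_graft w n).
pose m2 : {measure set binseq -> \bar R} := mscale r mg.
have rE : r%:num%:E = mu (cylinder w n) by rewrite fineK ?fin_num_measure.
rewrite -rE setIC.
apply: (@measure_unique _ _ _ boxes (fun=> setT) _ _ _ _ m1 m2) => //.
- exact: measurable_binseqE.
- exact: boxI_closed.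
- by move=> _; exists 0%N, (fun=> setT); apply/seteqP; split.
- by rewrite bigcup_const.
- move=> _ [m [A ->]]; rewrite /m1 /m2 /= /mrestr /mscale /mg /= /pushforward rE.
  rewrite (box_widen A (leq_maxr n m)) preimage_graft_box /cylinder.
  rewrite (box_widen (fun i => [set w i]) (leq_maxl n m)) boxI !mu_nu -big_split/=.
  apply: eq_bigr => i _; case: (ltnP i n) => _; last first.
    by rewrite setIT probability_setT mul1e.
  set A' := if _ then _ else _.
  (* The constraint on a grafted coordinate does not depend on the point: it always holds or never
     does. *)
  have [Aw|Aw] := pselect (A' (w i)).
    rewrite (_ : [set b | A' (w i)] = setT) ?probability_setT ?mule1; last first.
      by apply/seteqP; split.
    by congr (nu i _); apply/seteqP; split => [b []//|b ->]; split.
  rewrite (_ : [set b | A' (w i)] = set0) ?measure0 ?mule0; last first.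
    by apply/seteqP; split.
  rewrite (_ : _ `&` _ = set0) ?measure0//.
  by apply/seteqP; split => // b [/[swap] ->].
- move=> _; rewrite /m1 /= /mrestr setTI.
  by rewrite ltey_eq fin_num_measure.
Qed.

End cylinder_measure.

(** * From proportionality on strips to all measurable sets *)

Section proportional.
Context {R : realType} (mu : probability binseq R).
Notation leb := (@lebesgue_measure R).
Let m : {measure set (binseq * measurableTypeR R) -> \bar R} := (mu \x leb)%E.
Variables (A : set (binseq * measurableTypeR R)) (c : R).
Hypotheses (mA : measurable A) (c0 : 0 <= c).

Let bigcup_oc : \bigcup_(k : nat) (`](- k%:R)%R, k%:R]%classic) = [set: R].
Proof. exact: bigcup_itvT. Qed.

(** With the interval fixed, both sides are finite measures in [B] that agree on cylinders. *)
Let proportional_strip a b :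
  (forall w n, m (A `&` (cylinder w n `*` `]a, b])) =
    mu (cylinder w n) * (c%:E * leb `]a, b]))%E ->
  forall B, measurable B ->
    m (A `&` (B `*` `]a, b])) = (mu B * (c%:E * leb `]a, b]))%E.
Proof.
move=> AC B mB.
have [k kE] : exists k : {nonneg R}, (c%:E * leb `]a, b])%E = k%:num%:E.
  have lab : leb `]a, b] \is a fin_num.
    by rewrite lebesgue_measure_itv/=; case: ifP.
  have k0 : 0 <= c * fine (leb `]a, b]) by rewrite mulr_ge0 ?fine_ge0.
  by exists (NngNum k0) => /=; rewrite EFinM fineK.
have mAJ : measurable (A `&` (setT `*` `]a, b])).
  by apply: measurableI => //; exact: measurableX.
pose m1 : {measure set binseq -> \bar R} :=
  measure_function_pushforward__canonical__measure_function_Measure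
    (mrestr m mAJ) (@measurable_fst _ _ binseq (measurableTypeR R)).
have m1E X : m1 X = m (A `&` (X `*` `]a, b])).
  rewrite /m1/= /pushforward /mrestr; congr (product_measure1 _ _ _).
  by apply/seteqP; split => [[x t] /= [? [? []]]|[x t] /= [? []]].
pose m2 : {measure set binseq -> \bar R} := mscale k mu.
rewrite -m1E kE muleC.
apply/esym/(@measure_unique_cylinder _ m2 m1) => //.
  by apply: lte_mul_pinfty => //; rewrite ltey_eq fin_num_measure.
by move=> w n; rewrite m1E AC kE muleC.
Qed.

(** With [B] fixed, both sides are measures in [J], finite on bounded intervals, that agree on
    half-open intervals. *)
Let proportional_rectangle B :
  (forall a b, m (A `&` (B `*` `]a, b])) = (mu B * (c%:E * leb `]a, b]))%E) ->
  measurable B -> forall J, measurable J ->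
    m (A `&` (B `*` J)) = (c%:E * (mu B * leb J))%E.
Proof.
move=> AB mB J mJ.
have k0 : 0 <= c * fine (mu B) by rewrite mulr_ge0 ?fine_ge0.
pose k := NngNum k0.
have kE : k%:num%:E = (c%:E * mu B)%E by rewrite /k/= EFinM fineK ?fin_num_measure.
have mAB : measurable (A `&` (B `*` setT)).
  by apply: measurableI => //; exact: measurableX.
pose m1 : {measure set (measurableTypeR R) -> \bar R} :=
  measure_function_pushforward__canonical__measure_function_Measure
    (mrestr m mAB) (@measurable_snd _ _ binseq (measurableTypeR R)).
have m1E X : m1 X = m (A `&` (B `*` X)).
  rewrite /m1/= /pushforward /mrestr; congr (product_measure1 _ _ _).
  by apply/seteqP; split => [[x t] /= [? [? []]]|[x t] /= [? []]].
pose m2 : {measure set (measurableTypeR R) -> \bar R} := mscale k leb.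
have m2E X : m2 X = (c%:E * (mu B * leb X))%E by rewrite muleA -kE.
rewrite -m1E -m2E.
apply: esym; apply: (@measure_unique _ _ (measurableTypeR R) (@ocitv R)
  (fun k => `](- k%:R)%R, k%:R]%classic) _
  _ _ _ m2 m1) => //.
- exact: ocitvI.
- by move=> i; exact: is_ocitv.
- by move=> _ [[a b] _ <-]; rewrite m1E m2E AB muleCA.
- move=> i; rewrite m2E muleA -kE lebesgue_measure_itv/=.
  by case: ifP => _; rewrite ?mule0 ?ltry// -EFinB -EFinM ltry.
Qed.

(** Rectangles are reached one factor at a time, by the two preceding lemmas; they determine the two
    measures of [X]. *)
Lemma measure_proportional :
  (forall w n (a b : R), (a <= b)%R -> m (A `&` (cylinder w n `*` `]a, b])) =
    mu (cylinder w n) * (c%:E * leb `]a, b]))%E ->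
  forall X, measurable X -> m (A `&` X) = (c%:E * m X)%E.
Proof.
move=> AC X mX.
have AR B J : measurable B -> measurable J ->
    m (A `&` (B `*` J)) = (c%:E * (mu B * leb J))%E.
  move=> mB mJ; apply: proportional_rectangle => // a b.
  apply: proportional_strip => // w n.
  have [|ba] := leP a b; first exact: AC.
  have -> : `]a, b]%classic = set0 by rewrite set_itv_ge// bnd_simp -leNgt ltW.
  by rewrite setX0 setI0 !measure0 !mule0.
pose m1 : {measure set (binseq * measurableTypeR R) -> \bar R} := mrestr m mA.
pose m2 : {measure set (binseq * measurableTypeR R) -> \bar R} :=
  mscale (NngNum c0) m.
rewrite setIC.
pose G := [set B `*` J | B in @measurable _ binseq
                       & J in @measurable _ (measurableTypeR R)].
apply: esym; apply: (@measure_unique _ _ _ G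
  (fun k => setT `*` `](- k%:R)%R, k%:R]%classic) _ _ _ _ m2 m1) => //.
- exact: measurable_prod_measurableType.
- move=> _ _ [B1 mB1 [J1 mJ1 <-]] [B2 mB2 [J2 mJ2 <-]].
  rewrite -setXI; exists (B1 `&` B2); first exact: measurableI.
  by exists (J1 `&` J2) => //; exact: measurableI.
- by move=> i; exists setT => //; exists `](- i%:R), i%:R]%classic.
- by rewrite -setX_bigcupr bigcup_oc setXTT.
- move=> _ [B mB [J mJ <-]]; rewrite /m1 /m2/= /mrestr /mscale setIC AR//=.
  by rewrite product_measure1E.
- move=> i; apply: lte_mul_pinfty => //; rewrite /m/= product_measure1E//.
  apply: lte_mul_pinfty => //; first exact: fin_num_measure.
  by rewrite /= lebesgue_measure_itv/=; case: ifP; rewrite // -EFinB ltry.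
Qed.

End proportional.

(** * Conditional probabilities of an invariant set *)

Section fibers.
Context {R : realType} (nu : nat -> probability bool R) (mu : probability binseq R).
Notation leb := (@lebesgue_measure R).
Variables (e : nat -> R) (c : binseq -> binseq -> R).
Variable A : set (binseq * measurableTypeR R).
Hypothesis mu_nu : is_product_measure nu mu.
Hypothesis nu_gt0 : forall i b, 0 < fine (nu i [set b]).
Hypothesis cE : forall x y n, (forall i, (n <= i)%N -> x i = y i) ->
  c x y = \sum_(i < n) ((y i)%:R - (x i)%:R) * e i.
Hypothesis mA : measurable A.
Hypothesis A_invariant : invariant_set (skew_relation tail_equiv c) A.

Let zeros : nat -> bool := fun=> false.

Let fiber (w : nat -> bool) (n : nat) (t : R) : set binseq :=
  [set x : binseq | A (graft w n x, t)].

Let drift (w : nat -> bool) n : R := \sum_(i < n) (w i)%:R * e i.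

(* Replacing the first n coordinates by zeros moves (x, t) within its orbit,
   so fiber_prob n (t - drift w n) is the conditional probability of A given
   that x starts with w 0, ..., w n.-1 and that the real coordinate is t. *)
Definition fiber_prob n t : R := fine (mu (fiber zeros n t)).

Let fiberE w n t : fiber w n t = graft w n @^-1` ysection A t.
Proof. by apply/seteqP; split => x; rewrite /= ysectionP. Qed.

Let measurable_fiber w n t : measurable (fiber w n t).
Proof.
rewrite fiberE -[X in measurable X]setTI; apply: measurable_graft => //.
exact: measurable_ysection.
Qed.

Let fiber_drift (w : nat -> bool) n t : fiber w n t = fiber zeros n (t - drift w n).
Proof.
have wz (x : binseq) : skew_relation tail_equiv c (graft w n x, t)
    (graft zeros n x, t - drift w n).
  have tl i : (n <= i)%N -> graft w n x i = graft zeros n x i.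
    by rewrite /graft leqNgt => /negbTE ->.
  split; first by exists n.
  rewrite (cE tl)/= addrC /drift -sumrN; congr (_ + _); apply: eq_bigr => i _.
  by rewrite /graft ltn_ord sub0r mulNr.
by apply/seteqP; split => x Ax; apply/(A_invariant (wz x)).
Qed.

Let fiber_probE n t : mu (fiber zeros n t) = (fiber_prob n t)%:E.
Proof. by rewrite fineK// fin_num_measure. Qed.

Let measure_cylinder_ysection w n t :
  mu (cylinder w n `&` ysection A t) =
  (mu (cylinder w n) * (fiber_prob n (t - drift w n))%:E)%E.
Proof.
rewrite (measure_cylinderI mu_nu); last exact: measurable_ysection.
by rewrite -fiberE fiber_drift fiber_probE.
Qed.

Lemma fiber_prob01 n t : 0 <= fiber_prob n t <= 1.
Proof.
rewrite -!lee_fin -fiber_probE measure_ge0/=; exact: probability_le1.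
Qed.

(** The fibers are the sections of one measurable set, the preimage of [A] under grafting zeros on
    the first factor. *)
Lemma bounded_measurable_fiber_prob n : bounded_measurable (fiber_prob n).
Proof.
split; last first.
  by exists 1 => t; have /andP[? ?] := fiber_prob01 n t; rewrite ger0_norm.
have mg : measurable_fun setT
    (fun xt : binseq * measurableTypeR R => (graft zeros n xt.1, xt.2)).
  apply/measurable_fun_pairP; split => //=.
    exact: measurableT_comp (measurable_graft zeros n) measurable_fst.
  exact: measurable_snd.
have mB : measurable ((fun xt : binseq * measurableTypeR R =>
    (graft zeros n xt.1, xt.2)) @^-1` A).
  by rewrite -[X in measurable X]setTI; exact: mg.
apply/measurable_EFinP.
apply: eq_measurable_fun (measurable_fun_ysection mu mB) => t _ /=.
rewrite -fiber_probE; congr (mu _).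
by apply/seteqP; split => x; rewrite /= ysectionP.
Qed.

(** Total probability over coordinate [n]: by invariance, a 1 there amounts to a 0 with the real
    coordinate lowered by [e n]. *)
Lemma fiber_prob_average n : fiber_prob n =
  average (fine (nu n [set true])) (e n) (fiber_prob n.+1).
Proof.
apply/funext => t.
(* The word of [n] zeros followed by [b]. *)
pose wb b : nat -> bool := fun i => (i == n) && b.
have wb0 b i : (i < n)%N -> wb b i = false by move=> ni; rewrite /wb ltn_eqF.
have split_n : cylinder zeros n =
    cylinder (wb true) n.+1 `|` cylinder (wb false) n.+1.
  apply/seteqP; split => [x x0|x [] xb i ni]; last 2 first.
  - by rewrite (xb i (ltnW ni))/= wb0.
  - by rewrite (xb i (ltnW ni))/= wb0.
  have xwb b : x n = b -> cylinder (wb b) n.+1 x.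
    move=> xn i; rewrite ltnS leq_eqVlt /= => /predU1P[->|ni].
      by rewrite /wb eqxx.
    by rewrite wb0// (x0 i ni).
  by case xn : (x n); [left|right]; exact: xwb.
have disj : (cylinder (wb true) n.+1 `&` fiber zeros n t) `&`
    (cylinder (wb false) n.+1 `&` fiber zeros n t) = set0.
  apply/seteqP; split => // x [[x1 _] [x2 _]].
  by have := x1 n (ltnSn n); rewrite (x2 n (ltnSn n)) /= /wb eqxx.
pose P := \prod_(i < n) fine (nu i [set false]).
have P0 : P != 0 by rewrite gt_eqF// prodr_gt0.
have cylP b : mu (cylinder (wb b) n.+1) = (P * fine (nu n [set b]))%:E.
  rewrite (measure_cylinder mu_nu) big_ord_recr/= /wb eqxx/=; congr (_ * _)%:E.
  by apply: eq_bigr => i _; rewrite ltn_eqF.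
have cylS b : mu (cylinder (wb b) n.+1 `&` fiber zeros n t) =
    (P * fine (nu n [set b]) * fiber_prob n.+1 (t - b%:R * e n))%:E.
  rewrite (measure_cylinderI mu_nu)// cylP.
  rewrite (_ : _ @^-1` _ = fiber (wb b) n.+1 t).
    rewrite fiber_drift fiber_probE /drift big_ord_recr/= big1 ?add0r.
      by rewrite /wb eqxx.
    by move=> i _; rewrite wb0// mul0r.
  (* Since [wb b] begins with [n] zeros, grafting zeros over it changes nothing. *)
  rewrite /fiber; apply/seteqP; split => x /=;
    rewrite (_ : graft zeros n _ = graft (wb b) n.+1 x)//;
    apply/funext => i; rewrite /graft; case: ltnP => // ni;
    by rewrite ltnW// wb0.
have cyl0 : mu (cylinder zeros n `&` fiber zeros n t) = (P * fiber_prob n t)%:E.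
  rewrite (measure_cylinderI mu_nu)// (measure_cylinder mu_nu) EFinM -fiber_probE.
  congr (_ * mu _)%E; rewrite /fiber; apply/seteqP; split => x /=;
    rewrite (_ : graft zeros n (graft zeros n x) = graft zeros n x)//;
    by apply/funext => i; rewrite /graft; case: ltnP.
have measU : mu (cylinder zeros n `&` fiber zeros n t) =
    (mu (cylinder (wb true) n.+1 `&` fiber zeros n t) +
     mu (cylinder (wb false) n.+1 `&` fiber zeros n t))%E.
  by rewrite split_n setIUl; apply: measureU => //;
    apply: measurableI => //; exact: measurable_box.
move: cyl0; rewrite measU !cylS -EFinD mul1r mul0r subr0 => PE.
apply: (mulfI P0); rewrite -(EFin_inj PE) /average.
have -> : fine (nu n [set false]) = 1 - fine (nu n [set true]).
  have nu1 : (nu n [set true] + nu n [set false] = 1)%E.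
    rewrite -(probability_setT (nu n)) -measureU//.
      by congr (nu n _); apply/seteqP; split => // -[] _; [left|right].
    by apply/seteqP; split => // b [/= ->].
  have := congr1 fine nu1; rewrite fineD ?fin_num_measure//= => <-.
  by rewrite addrC addKr.
by ring.
Qed.

Lemma measure_strip w n (a b : R) :
  ((mu \x leb) (A `&` (cylinder w n `*` `]a, b])) =
  mu (cylinder w n) * (window (fiber_prob n) (a - drift w n) (b - drift w n))%:E)%E.
Proof.
have mX : measurable
    (A `&` (cylinder w n `*` (`]a, b]%classic : set (measurableTypeR R)))).
  apply: measurableI => //; apply: measurableX; first exact: measurable_box.
  exact: measurable_itv.
(* The order of integration is exchanged, so that the inner measure is that of a slice at fixed
   t. *)
transitivity ((mu \x^ leb) (A `&` (cylinder w n `*` `]a, b]%classic)))%E.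
  by apply: product_measure_unique => //= *; rewrite product_measure2E.
rewrite /product_measure2.
pose f t := (fiber_prob n (t - drift w n))%:E.
transitivity (\int[leb]_(t in `]a, b]) (mu (cylinder w n) * f t))%E.
  rewrite [RHS]integral_mkcond; apply: eq_integral => t _ /=.
  rewrite ysectionI patchE; case: ifPn => tab.
    by rewrite in_ysectionX// setIC measure_cylinder_ysection.
  by rewrite notin_ysectionX// setI0 measure0.
have bs := bounded_measurable_shift (drift w n) (bounded_measurable_fiber_prob n).
have fp0 t : 0 <= fiber_prob n t by have /andP[] := fiber_prob01 n t.
rewrite ge0_integralZl//; last 2 first.
- by apply/measurable_EFinP/measurable_funTS; case: bs.
- by move=> t _; rewrite lee_fin.
congr (_ * _)%E; rewrite -window_shift//; last exact: bounded_measurable_fiber_prob.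
rewrite /window /Rintegral fineK//.
exact: integrable_fin_num (integrable_itvoc a b bs).
Qed.

End fibers.

(** * The cocycle in coordinates, and the proof of ergodicity *)

(** The odds of a 1 at i are exp (ln lambda + eps i), so the logarithm of each factor is (y i - x i)
    * (ln lambda + eps i), and the terms in ln lambda cancel. *)
Lemma ln_Radon_Nikodym_sub_count {R : realType} (lambda : R) (eps : nat -> R)
    (nu : nat -> probability bool R) (x y : binseq) n :
  0 < lambda ->
  (forall i, nu i [set false] = (1 / (1 + lambda * expR (eps i)))%:E) ->
  (forall i, nu i [set true] =
    (lambda * expR (eps i) / (1 + lambda * expR (eps i)))%:E) ->
  (forall i, (n <= i)%N -> x i = y i) ->
  ln (Radon_Nikodym_cocycle nu x y) - count_cocycle (ln lambda) x y =
  \sum_(i < n) ((y i)%:R - (x i)%:R) * eps i.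
Proof.
move=> l0 nuF nuT xy.
have q0 i : 0 < lambda * expR (eps i) by rewrite mulr_gt0 ?expR_gt0.
have Q0 i : 0 < 1 + lambda * expR (eps i) by rewrite addr_gt0.
rewrite (count_cocycleE _ xy) (Radon_Nikodym_cocycleE _ xy); last first.
  by move=> i [|]; rewrite ?nuF ?nuT lte_fin divr_gt0.
have -> : \prod_(i < n) (fine (nu i [set y i]) / fine (nu i [set x i])) =
    expR (\sum_(i < n) ((y i)%:R - (x i)%:R) * (ln lambda + eps i)).
  rewrite expR_sum; apply: eq_bigr => i _.
  have qE : lambda * expR (eps i) = expR (ln lambda + eps i).
    by rewrite expRD lnK// posrE.
  have QN0 : 1 + expR (ln lambda + eps i) != 0 by rewrite -qE gt_eqF.
  have eN0 : expR (ln lambda + eps i) != 0 by rewrite gt_eqF// expR_gt0.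
  case: (x i); case: (y i); rewrite ?nuF ?nuT/= qE.
  - by rewrite subrr mul0r expR0; field; rewrite QN0 eN0.
  - by rewrite sub0r mulN1r expRN; field; rewrite QN0 eN0.
  - by rewrite subr0 !mul1r; field; rewrite QN0.
  - by rewrite subrr mul0r expR0; field; rewrite QN0.
rewrite expRK -sumrB; apply: eq_bigr => i _; ring.
Qed.

(** A bound on the sums from [m] on, together with the first [m] terms, would bound the whole
    series. The offset serves to start the martingale at any level. *)
Lemma partial_sums_unbounded {R : realType} (a : nat -> R) :
  (forall i, 0 <= a i) -> (\sum_(0 <= i <oo) (a i)%:E = +oo)%E ->
  forall m (M : R), exists N, M <= \sum_(i < N) a (i + m)%N.
Proof.
move=> a0 aoo m M; apply: contrapT => noN.
have aM N : \sum_(i < N) a (i + m)%N <= M.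
  by rewrite leNgt; apply/negP => h; apply: noN; exists N; exact: ltW.
suff : (\sum_(0 <= i <oo) (a i)%:E <= (\sum_(i < m) a i + M)%:E)%E by rewrite aoo.
apply: lime_le; first by apply: is_cvg_nneseries => i _ _; rewrite lee_fin.
apply: nearW => N; rewrite sumEFin lee_fin big_mkord.
apply: (@le_trans _ _ (\sum_(i < m + N) a i)).
  rewrite (big_ord_widen_cond (m + N) xpredT a (leq_addl _ _)).
  by rewrite big_mkcond/=; apply: ler_sum => i _; case: ifP.
rewrite big_split_ord/= lerD2l.
by under eq_bigr do rewrite addnC; exact: aM.
Qed.

(** With q = lambda * expR (eps i), p * (1 - p) equals q / (1 + q) ^ 2, and [eps] is bounded because
    it converges. *)
Lemma logistic_variance_bound {R : realType} (lambda : R) (eps : nat -> R) :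
  0 < lambda -> eps @ \oo --> 0 -> exists2 d, 0 < d &
  forall i p, p = lambda * expR (eps i) / (1 + lambda * expR (eps i)) ->
    d <= p * (1 - p).
Proof.
move=> l0 e0.
have [B epsB] : exists B, forall i, `|eps i| <= B.
  have /cvg_seq_bounded/pinfty_ex_gt0[B _ epsB] : cvgn eps by apply/cvg_ex; exists 0.
  by exists B => i; exact: epsB.
exists (lambda * expR (- B) / (1 + lambda * expR B) ^+ 2).
  by rewrite divr_gt0 ?mulr_gt0 ?exprn_gt0 ?addr_gt0 ?mulr_gt0 ?expR_gt0.
move=> i p pE; have := epsB i; rewrite ler_norml => /andP[Be eB].
have q0 : 0 < lambda * expR (eps i) by rewrite mulr_gt0 ?expR_gt0.
have -> : p * (1 - p) = lambda * expR (eps i) / (1 + lambda * expR (eps i)) ^+ 2.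
  by rewrite pE; field; rewrite gt_eqF// addr_gt0.
have qB : 0 < lambda * expR B by rewrite mulr_gt0 ?expR_gt0.
apply: ler_pM.
- by rewrite mulr_ge0 ?expR_ge0 ?ltW.
- by rewrite invr_ge0 exprn_ge0// addr_ge0// ltW.
- by rewrite ler_pM2l// ler_expR.
rewrite lef_pV2 ?posrE; try by rewrite exprn_gt0// addr_gt0.
rewrite ler_sqr ?nnegrE; try by rewrite addr_ge0// ltW.
by rewrite lerD2l ler_pM2l// ler_expR.
Qed.

Theorem proposition1p5 (R : realType) (lambda : R) (eps : nat -> R)
    (nu : nat -> probability bool R) (mu : probability binseq R) :
  0 < lambda <= 1 ->
  eps @ \oo --> 0 ->
  (\sum_(0 <= i <oo) (eps i ^+ 2)%:E = +oo)%E ->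
  (forall i, nu i [set false] = (1 / (1 + lambda * expR (eps i)))%:E) ->
  (forall i, nu i [set true] =
    (lambda * expR (eps i) / (1 + lambda * expR (eps i)))%:E) ->
  is_product_measure nu mu ->
  ergodic_cocycle mu tail_equiv
    (fun x y => ln (Radon_Nikodym_cocycle nu x y)
                - count_cocycle (ln lambda) x y).
Proof.
move=> /andP[l0 _] e0 e2oo nuF nuT mu_nu A mA A_inv.
have cE x y n : (forall i, (n <= i)%N -> x i = y i) ->
    ln (Radon_Nikodym_cocycle nu x y) - count_cocycle (ln lambda) x y =
    \sum_(i < n) ((y i)%:R - (x i)%:R) * eps i.
  exact: ln_Radon_Nikodym_sub_count.
have q0 i : 0 < lambda * expR (eps i) by rewrite mulr_gt0 ?expR_gt0.
have nu_gt0 i b : 0 < fine (nu i [set b]).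
  by case: b; rewrite ?nuF ?nuT/= divr_gt0// addr_gt0.
pose p i := fine (nu i [set true]).
have p01 i : 0 <= p i <= 1.
  rewrite /p fine_ge0//= -lee_fin fineK ?fin_num_measure//; exact: probability_le1.
have [d d0 dp] := logistic_variance_bound l0 e0.
have {}dp i : d <= p i * (1 - p i) by apply: dp; rewrite /p nuT.
have phiE := fiber_prob_average mu_nu nu_gt0 cE mA A_inv.
pose phi := fiber_prob mu A; rewrite -/phi in phiE.
have bphi n : bounded_measurable (phi n) by exact: bounded_measurable_fiber_prob.
have phi01 n t : 0 <= phi n t <= 1 by exact: fiber_prob01.
have phi0 n t : 0 <= phi n t by have /andP[] := phi01 n t.
have window_phi m : exists k, forall a b, a <= b -> window (phi m) a b = k * (b - a).
  apply: window_linear => // s r r0.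
  (* The range of controlled translations is taken to be |s|, and the martingale starts at level
     [m]. *)
  have C0 : 0 <= 2 * oneDsqr `|s| :> R by rewrite mulr_ge0.
  apply: (@exists_small_shift _ _ _ _ (fun i => p (i + m)%N)
    (fun i => eps (i + m)%N) (fun i => phi (i + m)%N)
    (quasi_invariant_weighted_integral `|s|) C0 _ _ _ _ d) => //.
  - by move=> n; rewrite addSn; exact: phiE.
  - by rewrite (@cvg_shiftn m).
  - apply: (partial_sums_unbounded (a := fun i => eps i ^+ 2)) => // i.
    exact: sqr_ge0.
pose k := window (phi 0%N) 0 1.
have k0 : 0 <= k by exact: Rintegral_ge0.
(* The slope is the same at all levels: in the average that gives [phi m], [phi m.+1] and its
   translate have equal integrals over ]0, 1]. *)
have window_phiE m a b : a <= b -> window (phi m) a b = k * (b - a).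
  suff km : window (phi m) 0 1 = k.
    move=> ab; have [k' k'E] := window_phi m.
    by rewrite k'E// -km k'E// subr0 mulr1.
  elim: m => // m <-; have [k' k'E] := window_phi m.+1.
  have bs := bounded_measurable_shift (eps m) (bphi m.+1).
  rewrite (phiE m) /average [in RHS]/window RintegralD//=; last 2 first.
  - exact: integrable_itvoc (bounded_measurableZ _ (bphi m.+1)).
  - exact: integrable_itvoc (bounded_measurableZ _ bs).
  rewrite !RintegralZl//=; try exact: integrable_itvoc.
  rewrite -/(window _ 0 1) -/(window (fun x => phi m.+1 (x - eps m)) 0 1).
  rewrite window_shift// !k'E ?lerD2r//; ring.
have kA := measure_proportional mA k0.
have {kA} kA X : measurable X -> ((mu \x lebesgue_measure) (A `&` X) =
    k%:E * (mu \x lebesgue_measure) X)%E.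
  apply: kA => w n a b ab.
  apply: etrans (measure_strip mu_nu cE mA A_inv w n a b) _.
  rewrite window_phiE ?lerD2r//.
  congr (_ * _)%E; rewrite lebesgue_measure_itv/= lte_fin.
  rewrite opprB addrA subrK; case: ltP => ba; first by rewrite -EFinB -EFinM.
  by rewrite (le_anti (introT andP (conj ab ba))) subrr mulr0 mule0.
have kAC := kA _ (measurableC mA); rewrite setICr measure0 in kAC.
have [k00|kn0] := eqVneq k 0.
  by left; rewrite -(setIid A) kA// k00 mul0e.
by right; apply/eqP; move/eqP: kAC; rewrite eq_sym mule_eq0 eqe (negbTE kn0).
Qed.
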